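(* Let $f:\mathbb{R}^n\to\mathbb{R}$ be a strongly convex function with Lipschitz continuous gradient $\nabla f$, let $g:\mathbb{R}^d\to\mathbb{R}$ be a lower semicontinuous convex function, and let $T\in\mathbb{R}^{d\times n}$ be a matrix with full row rank. For $\mu>0$ let $$\mathcal{L}_\mu(x;y)=f(x)+\mathcal{M}_{\mu g}(Tx+\mu y)-\tfrac{\mu}{2}\|y\|^2,\qquad x\in\mathbb{R}^n,\ y\in\mathbb{R}^d,$$ be the proximal augmented Lagrangian associated with the problem of minimizing $f(x)+g(Tx)$ over $x\in\mathbb{R}^n$, and, with $z=(x,y)\in\mathbb{R}^{n+d}$, let $$F(z)=\begin{bmatrix}-\nabla_x\mathcal{L}_\mu(x;y)\\ \nabla_y\mathcal{L}_\mu(x;y)\end{bmatrix}=\begin{bmatrix}-\nabla f(x)-T^{T}\nabla\mathcal{M}_{\mu g}(Tx+\mu y)\\ \mu\big(\nabla\mathcal{M}_{\mu g}(Tx+\mu y)-y\big)\end{bmatrix}.$$ Then, for any $\mu>0$ and any $\eta_1,\eta_2,\lambda_2>0$, $\lambda_1\in(0,1)$, the unique saddle point of $\mathcal{L}_\mu$ is a globally fixed-time stable equilibrium point of $$\dot z=\sigma(z)F(z),\qquad \sigma(z)=\begin{cases}0, & F(z)=0,\\ \eta_1\|F(z)\|^{-\lambda_1}+\eta_2\|F(z)\|^{\lambda_2}, & \text{otherwise.}\end{cases}$$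
   Context: $\|\cdot\|$ is the Euclidean norm. Moreau envelope: for $\mu>0$, $\mathcal{M}_{\mu g}(v)=\min_{w\in\mathbb{R}^d}\, g(w)+\frac{1}{2\mu}\|w-v\|^2$. It is continuously differentiable with $\nabla\mathcal{M}_{\mu g}(v)=\frac1\mu\big(v-\mathbf{prox}_{\mu g}(v)\big)$, where $\mathbf{prox}_{\mu g}(v)=\operatorname{argmin}_{w}\, g(w)+\frac{1}{2\mu}\|w-v\|^2$. Saddle point: $(x^\star,y^\star)$ is a saddle point of $\mathcal{L}_\mu$ if $\mathcal{L}_\mu(x^\star;y)\le\mathcal{L}_\mu(x^\star;y^\star)\le\mathcal{L}_\mu(x;y^\star)$ for all $x\in\mathbb{R}^n$, $y\in\mathbb{R}^d$. Global finite-time stability: an equilibrium point $z^\star$ of a system $\dot z=G(z)$ is globally finite-time stable if (i) it is stable in the sense of Lyapunov, and (ii) there is a settling-time function $\tau:\mathbb{R}^{n+d}\to[0,\infty)$ such that the solution starting from $z(0)$ satisfies $\lim_{t\to\tau(z(0))}z(t)=z^\star$; here $\tau(z(0))$ is the first time at which the solution reaches $z^\star$. Global fixed-time stability: $z^\star$ is globally fixed-time stable if it is globally finite-time stable and $\sup_{z}\tau(z)<\infty$. *)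

(* Defs.v *)
From HB Require Import structures.
From mathcomp Require Import all_boot all_order all_algebra.
From mathcomp Require Import all_classical all_reals all_analysis.

Set Implicit Arguments.
Unset Strict Implicit.
Unset Printing Implicit Defensive.

Import Order.TTheory GRing.Theory Num.Theory.
Import numFieldNormedType.Exports.

Local Open Scope classical_set_scope.
Local Open Scope ring_scope.

(* The library norm on 'cV[R]_n is the sup norm, hence a separate definition;
   both norms induce the same topology and the same differentiability notions,
   for which the library's are used. *)
Definition enorm (R : realType) (n : nat) (v : 'cV[R]_n) : R :=
  Num.sqrt (\sum_(i < n) v i 0 ^+ 2).

(* The vector of partial derivatives. *)
Definition grad (R : realType) (n : nat) (f : 'cV[R]_n -> R) (x : 'cV[R]_n) :
    'cV[R]_n :=
  \col_(i < n) 'D_(delta_mx i 0) f x.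

Definition strongly_convex (R : realType) (n : nat) (f : 'cV[R]_n -> R) : Prop :=
  exists2 m : R, 0 < m &
    convex_function setT (fun x : 'cV[R]_n => f x - m / 2 * enorm x ^+ 2).

Definition lipschitz_gradient (R : realType) (n : nat) (f : 'cV[R]_n -> R) :
    Prop :=
  (forall x, differentiable f x) /\
  exists C : R, forall x y, enorm (grad f x - grad f y) <= C * enorm (x - y).

(* The minimum defining the envelope is written as an infimum; it is attained
   when mu > 0 and g is convex and lower semicontinuous. *)
Definition moreau (R : realType) (d : nat) (mu : R) (g : 'cV[R]_d -> R)
    (v : 'cV[R]_d) : R :=
  inf (range (fun w : 'cV[R]_d => g w + (2 * mu)^-1 * enorm (w - v) ^+ 2)).

Definition prox_aug_lagrangian (R : realType) (n d : nat) (f : 'cV[R]_n -> R)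
    (g : 'cV[R]_d -> R) (T : 'M[R]_(d, n)) (mu : R)
    (x : 'cV[R]_n) (y : 'cV[R]_d) : R :=
  f x + moreau mu g (T *m x + mu *: y) - mu / 2 * enorm y ^+ 2.

(* z : 'cV_(n + d) stands for the pair (x, y), with x = usubmx z and
   y = dsubmx z. *)
Definition is_saddle_point (R : realType) (n d : nat)
    (L : 'cV[R]_n -> 'cV[R]_d -> R) (z : 'cV[R]_(n + d)) : Prop :=
  forall (x : 'cV[R]_n) (y : 'cV[R]_d),
    L (usubmx z) y <= L (usubmx z) (dsubmx z) <= L x (dsubmx z).

Definition primal_dual_field (R : realType) (n d : nat)
    (L : 'cV[R]_n -> 'cV[R]_d -> R) (z : 'cV[R]_(n + d)) : 'cV[R]_(n + d) :=
  col_mx (- grad (fun x => L x (dsubmx z)) (usubmx z))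
         (grad (fun y => L (usubmx z) y) (dsubmx z)).

Definition rescaling (R : realType) (N : nat) (eta1 eta2 lambda1 lambda2 : R)
    (F : 'cV[R]_N -> 'cV[R]_N) (z : 'cV[R]_N) : R :=
  if F z == 0 then 0
  else eta1 * enorm (F z) `^ (- lambda1) + eta2 * enorm (F z) `^ lambda2.

(* Classical solutions on [0, +oo[ of z' = G(z), z(0) = z0; values of z at
   negative times are irrelevant. For continuous G, the one-sided equation at
   t = 0 follows from continuity of z at 0 and the equation for t > 0. *)
Definition is_solution (R : realType) (N : nat) (G : 'cV[R]_N -> 'cV[R]_N)
    (z0 : 'cV[R]_N) (z : R -> 'cV[R]_N) : Prop :=
  [/\ z 0 = z0,
      {within `[0, +oo[%classic, continuous z} &
      forall t : R, 0 < t -> is_derive t 1 z (G (z t))].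

Definition is_equilibrium (R : realType) (N : nat) (G : 'cV[R]_N -> 'cV[R]_N)
    (zs : 'cV[R]_N) : Prop := G zs = 0.

Definition lyapunov_stable (R : realType) (N : nat) (G : 'cV[R]_N -> 'cV[R]_N)
    (zs : 'cV[R]_N) : Prop :=
  forall e : R, 0 < e -> exists2 delta : R, 0 < delta &
    forall z0 z, enorm (z0 - zs) < delta -> is_solution G z0 z ->
      forall t : R, 0 <= t -> enorm (z t - zs) < e.

(* tau z0 is the first time at which the solution from z0 reaches zs. *)
Definition is_settling_time (R : realType) (N : nat)
    (G : 'cV[R]_N -> 'cV[R]_N) (zs : 'cV[R]_N) (tau : 'cV[R]_N -> R) : Prop :=
  forall z0, 0 <= tau z0 /\
    forall z, is_solution G z0 z ->
      [/\ z t @[t --> within `[0, +oo[%classic (nbhs (tau z0))] --> zs,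
          z (tau z0) = zs &
          forall t : R, 0 <= t < tau z0 -> z t <> zs].

(* "The solution starting from z0" is rendered by requiring that a solution on
   [0, +oo[ exist for every z0, and by quantifying over all solutions in the
   stability and settling-time conditions. *)
Definition globally_solvable (R : realType) (N : nat)
    (G : 'cV[R]_N -> 'cV[R]_N) : Prop :=
  forall z0, exists z : R -> 'cV[R]_N, is_solution G z0 z.

Definition globally_finite_time_stable (R : realType) (N : nat)
    (G : 'cV[R]_N -> 'cV[R]_N) (zs : 'cV[R]_N) : Prop :=
  [/\ is_equilibrium G zs, globally_solvable G, lyapunov_stable G zs &
      exists tau : 'cV[R]_N -> R, is_settling_time G zs tau].

(* A settling-time function is determined by G and zs once G is globally
   solvable, so tau is the one given by finite-time stability. *)
Definition globally_fixed_time_stable (R : realType) (N : nat)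
    (G : 'cV[R]_N -> 'cV[R]_N) (zs : 'cV[R]_N) : Prop :=
  globally_finite_time_stable G zs /\
  exists2 tau : 'cV[R]_N -> R, is_settling_time G zs tau &
    has_ubound (range tau).

(* Main.v *)
Require Import Defs.
From HB Require Import structures.
From mathcomp Require Import all_boot all_order all_algebra.
From mathcomp Require Import all_classical all_reals all_analysis.
From mathcomp Require Import ring lra.
Import Order.TTheory GRing.Theory Num.Theory.
Import numFieldNormedType.Exports.
Local Open Scope classical_set_scope.
Local Open Scope ring_scope.

(**
  For a small [e] the field [F] is strongly monotone in the inner product of
  the block matrix [[1, e T^T], [e T, 1]]: the prox residual
  [q v = (v - prox v) / mu] is [mu]-cocoercive, which yields decay of [x] and
  of [q - y], and the cross term recovers [y] because [T^T] is injective. So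
  [z + s F z] is a contraction for small [s] and [F] has a unique zero, which
  is the saddle point. With [E] the squared distance to it in this inner
  product, the flow [w' = F w] satisfies [E' <= - k E].

  Solutions of the rescaled system are the curves [w] read with the clock
  [th' = 1 / sigma (w)]. Since [sigma (w)] dominates
  [(1 + E^p)^2 / E^p] up to a constant, with [2 p = min lambda1 lambda2],
  [th] is bounded by a multiple of [E^p / (1 + E^p)] at time [0], hence
  uniformly in the starting point; the settling time is the limit of [th].
*)

(** * Euclidean inner product and calculus of curves *)

(** The rescaled field has norm of order [|F|^(1 - lambda1)] near its zero and superlinear growth at
    infinity, so Picard iteration does not apply to it. It is therefore run on the Lipschitz field
    [F] only. The flow of [F] never reaches the zero in finite time, hence [sigma] is positive and
    continuous along it and a change of time is legitimate. Uniqueness cannot come from a Lipschitz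
    bound either: an arbitrary solution is matched with the reparametrized flow by monotonicity, as
    long as it avoids the zero, and an energy argument excludes an early arrival.

    The comparison function [(1 + E^p)^2 / E^p] is dictated by the derivative of [1 / (1 + E^p)]:
    along [E' <= - k E] the bound on the clock integrates in closed form. Its terms [E^p] and
    [E^(-p)] mirror the two powers in [sigma].

    The gradient of the envelope is never obtained by differentiating an infimum. The variational
    inequality of the proximal point gives two-sided quadratic bounds, and these yield the gradient,
    its Lipschitz constant and the saddle inequalities. *)

Definition dot {R : realType} {n : nat} (u v : 'cV[R]_n) : R :=
  \sum_(i < n) u i 0 * v i 0.

Section Dot.
Context {R : realType} {n : nat}.
Implicit Types (u v w : 'cV[R]_n) (k : R).

Lemma dotC u v : dot u v = dot v u.
Proof. by apply: eq_bigr => i _; rewrite mulrC. Qed.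

Lemma dotDl u v w : dot (u + v) w = dot u w + dot v w.
Proof. by rewrite -big_split; apply: eq_bigr => i _; rewrite mxE mulrDl. Qed.

Lemma dotZl k u w : dot (k *: u) w = k * dot u w.
Proof. by rewrite mulr_sumr; apply: eq_bigr => i _; rewrite mxE mulrA. Qed.

Lemma dotNl u w : dot (- u) w = - dot u w.
Proof. by rewrite -scaleN1r dotZl mulN1r. Qed.

Lemma dotBl u v w : dot (u - v) w = dot u w - dot v w.
Proof. by rewrite dotDl dotNl. Qed.

Lemma dotDr u v w : dot u (v + w) = dot u v + dot u w.
Proof. by rewrite dotC dotDl !(dotC u). Qed.

Lemma dotZr k u w : dot u (k *: w) = k * dot u w.
Proof. by rewrite dotC dotZl dotC. Qed.

Lemma dotNr u w : dot u (- w) = - dot u w.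
Proof. by rewrite dotC dotNl dotC. Qed.

Lemma dotBr u v w : dot u (v - w) = dot u v - dot u w.
Proof. by rewrite dotDr dotNr. Qed.

Lemma dot0l u : dot 0 u = 0.
Proof. by rewrite /dot big1// => i _; rewrite mxE mul0r. Qed.

Lemma dot0r u : dot u 0 = 0. Proof. by rewrite dotC dot0l. Qed.

Lemma dot_sqrD u k v :
  dot (u + k *: v) (u + k *: v) = dot u u + 2 * k * dot u v + k ^+ 2 * dot v v.
Proof. by rewrite dotDl !dotDr !dotZl !dotZr (dotC v u); ring. Qed.

Lemma dot_ge0 u : 0 <= dot u u.
Proof. by apply: sumr_ge0 => i _; rewrite -expr2 sqr_ge0. Qed.

Lemma coord_sqr_le_dot u i : u i 0 ^+ 2 <= dot u u.
Proof.
rewrite /dot (bigD1 i)//= -expr2 lerDl.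
by apply: sumr_ge0 => j _; rewrite -expr2 sqr_ge0.
Qed.

Lemma dot_eq0 u : (dot u u == 0) = (u == 0).
Proof.
apply/eqP/eqP => [u0|->]; last exact: dot0l.
apply/matrixP => i j; rewrite ord1 mxE; apply/eqP.
by rewrite -sqrf_eq0 eq_le sqr_ge0 andbT -u0 coord_sqr_le_dot.
Qed.

Lemma dot_gt0 u : (0 < dot u u) = (u != 0).
Proof. by rewrite lt_def dot_eq0 dot_ge0 andbT. Qed.

Lemma dot_enorm u : dot u u = enorm u ^+ 2.
Proof.
rewrite /enorm sqr_sqrtr; last by apply: sumr_ge0 => i _; exact: sqr_ge0.
by apply: eq_bigr => i _; rewrite expr2.
Qed.

Lemma enorm_ge0 u : 0 <= enorm u. Proof. exact: sqrtr_ge0. Qed.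

Lemma enormE u : enorm u = Num.sqrt (dot u u).
Proof. by congr Num.sqrt; apply: eq_bigr => i _; rewrite expr2. Qed.

Lemma enorm_eq0 u : (enorm u == 0) = (u == 0).
Proof. by rewrite -sqrf_eq0 -dot_enorm dot_eq0. Qed.

Lemma enorm_gt0 u : (0 < enorm u) = (u != 0).
Proof. by rewrite lt_def enorm_eq0 enorm_ge0 andbT. Qed.

Lemma enorm_lt_sqr u k : 0 < k -> (enorm u < k) = (dot u u < k ^+ 2).
Proof. by move=> k0; rewrite dot_enorm ltr_pXn2r// nnegrE ?enorm_ge0// ltW. Qed.

Lemma enormZ k u : enorm (k *: u) = `|k| * enorm u.
Proof.
by rewrite !enormE dotZl dotZr mulrA -expr2 sqrtrM ?sqr_ge0// sqrtr_sqr.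
Qed.

Lemma coord_le_enorm u i : `|u i 0| <= enorm u.
Proof.
by rewrite -(@ler_pXn2r _ 2)// ?nnegrE ?enorm_ge0// real_normK ?num_real//
  -dot_enorm coord_sqr_le_dot.
Qed.

Lemma dot_young k u v : 0 < k -> 2 * dot u v <= k * dot u u + k^-1 * dot v v.
Proof.
move=> k0; have := dot_ge0 (k *: u - v).
rewrite dotBl !dotBr !dotZl !dotZr (dotC v u) => h.
rewrite -(ler_pM2l k0) mulrDr (mulrA k k^-1) divff ?gt_eqF// mul1r.
by nra.
Qed.

Lemma dot_young' k u v : 0 < k -> - (2 * dot u v) <= k * dot u u + k^-1 * dot v v.
Proof.
move=> k0; have := dot_young _ (- u) v k0.
by rewrite !dotNl !dotNr opprK mulrN.
Qed.

Lemma cauchy_schwarz u v : dot u v ^+ 2 <= dot u u * dot v v.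
Proof.
have [->|v0] := eqVneq v 0; first by rewrite !dot0r expr0n mulr0.
have v1 : 0 < dot v v by rewrite dot_gt0.
have := dot_ge0 (dot v v *: u - dot u v *: v).
rewrite dotBl !dotBr !dotZl !dotZr (dotC v u) => h.
by rewrite -subr_ge0 -(pmulr_rge0 _ v1); lra.
Qed.

Lemma dot_le_enorm u v : `|dot u v| <= enorm u * enorm v.
Proof.
rewrite -(@ler_pXn2r _ 2)// ?nnegrE ?mulr_ge0 ?enorm_ge0//.
by rewrite real_normK ?num_real// exprMn -!dot_enorm cauchy_schwarz.
Qed.

Lemma enormD u v : enorm (u + v) <= enorm u + enorm v.
Proof.
rewrite -(@ler_pXn2r _ 2)// ?nnegrE ?addr_ge0 ?enorm_ge0//.
rewrite -dot_enorm dotDl !dotDr (dotC v u) sqrrD -!dot_enorm.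
have := dot_le_enorm u v; have := ler_norm (dot u v); lra.
Qed.

Lemma enormN u : enorm (- u) = enorm u.
Proof. by rewrite -scaleN1r enormZ normrN1 mul1r. Qed.

Lemma enorm_distC u v : enorm (u - v) = enorm (v - u).
Proof. by rewrite -enormN opprB. Qed.

End Dot.

Lemma dot_col_mx {R : realType} {m n : nat} (a c : 'cV[R]_m) (b d : 'cV[R]_n) :
  dot (col_mx a b) (col_mx c d) = dot a c + dot b d.
Proof.
rewrite /dot big_split_ord/=; congr (_ + _); apply: eq_bigr => i _.
  by rewrite !col_mxEu.
by rewrite !col_mxEd.
Qed.

Lemma dot_adj {R : realType} {m n : nat} (A : 'M[R]_(m, n)) (x : 'cV[R]_n) y :
  dot (A *m x) y = dot x (A^T *m y).
Proof.
have E p (u v : 'cV[R]_p) : dot u v = (u^T *m v) 0 0.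
  by rewrite mxE; apply: eq_bigr => i _; rewrite mxE.
by rewrite !E trmx_mul mulmxA.
Qed.

(** Cauchy-Schwarz on each row gives the squared Frobenius norm as a constant; the added 1 keeps it
    positive when [A = 0]. *)
Lemma mulmx_bounded {R : realType} {m n : nat} (A : 'M[R]_(m, n)) :
  exists2 b : R, 0 < b & forall x : 'cV[R]_n, dot (A *m x) (A *m x) <= b * dot x x.
Proof.
pose b := \sum_(i < m) dot (row i A)^T (row i A)^T.
have b0 : 0 <= b by apply: sumr_ge0 => i _; exact: dot_ge0.
exists (b + 1) => [|x]; first by rewrite ltr_wpDl.
rewrite (@le_trans _ _ (b * dot x x))//; last first.
  by rewrite ler_wpM2r ?dot_ge0// lerDl.
rewrite {1}/dot mulr_suml; apply: ler_sum => i _.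
have -> : (A *m x) i 0 = dot (row i A)^T x.
  by rewrite mxE; apply: eq_bigr => j _; rewrite !mxE.
by rewrite -expr2 cauchy_schwarz.
Qed.

(** * Limits, derivatives and monotonicity along curves *)

Section Calculus.
Context {R : realType}.
Implicit Types t : R.

Lemma cvg_coordP {T : Type} (F : set_system T) {FF : Filter F} {n : nat}
    (f : T -> 'cV[R]_n) (l : 'cV[R]_n) :
  (f @ F --> l) <-> forall i, (fun x => f x i 0) @ F --> l i 0.
Proof.
split=> [fl i|fl].
  apply: (@continuous_cvg _ _ _ F _ f (fun v : 'cV[R]_n => v i 0)) fl.
  exact: coord_continuous.
apply/cvgrPdist_le => e e0.
have H : \forall x \near F, forall i : 'I_n, `|l i 0 - f x i 0| <= e.
  by apply: filter_forall => i; have /cvgrPdist_le := fl i; exact.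
apply: filterS H => x H.
rewrite /Num.Def.normr/= mx_normrE; apply: bigmax_le => [|[i j] _]; first exact: ltW.
by rewrite (ord1 j) !mxE.
Qed.

Lemma continuous_compf {T U V : topologicalType} (f : T -> U) (g : U -> V) x :
  {for x, continuous f} -> {for f x, continuous g} ->
  {for x, continuous (fun y => g (f y))}.
Proof. by move=> cf cg; exact: (@continuous_comp _ _ _ f g). Qed.

Lemma cvg_sumf {T : Type} (F : set_system T) {FF : Filter F} {n : nat}
    (f : 'I_n -> T -> R) (l : 'I_n -> R) :
  (forall i, f i x @[x --> F] --> l i) ->
  (\sum_i f i x) @[x --> F] --> \sum_i l i.
Proof.
move=> H; rewrite (_ : (fun x => _) = \sum_i f i); last first.
  by apply/funext => x; rewrite fct_sumE.
apply: (@big_ind2 _ _ (fun (g : T -> R) (m : R) => g x @[x --> F] --> m)) => //.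
- exact: cvg_cst.
- by move=> g1 m1 g2 m2; exact: cvgD.
Qed.

Lemma enorm_continuous {n : nat} : continuous (@enorm R n).
Proof.
move=> v; apply: (@continuous_comp _ _ _ (fun u : 'cV[R]_n => \sum_(i < n) u i 0 ^+ 2)
  Num.sqrt); last exact: sqrt_continuous.
apply: (@cvg_sumf _ (nbhs v)) => i.
by apply: cvgM; exact: coord_continuous.
Qed.

Lemma cvg_enormP {T : Type} (F : set_system T) {FF : Filter F} {n : nat}
    (f : T -> 'cV[R]_n) (l : 'cV[R]_n) :
  (f @ F --> l) <-> forall e, 0 < e -> \forall x \near F, enorm (f x - l) < e.
Proof.
split=> [fl e e0|fl].
  have /cvgrPdist_lt/(_ e e0) : enorm (f x - l) @[x --> F] --> enorm (l - l : 'cV[R]_n).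
    apply: continuous_cvg; first exact: enorm_continuous.
    by apply: cvgB => //; exact: cvg_cst.
  have -> : enorm (l - l) = 0 by apply/eqP; rewrite enorm_eq0 subrr.
  by apply: filterS => x; rewrite sub0r normrN ger0_norm ?enorm_ge0.
apply/cvg_coordP => i; apply/cvgrPdist_lt => e e0.
apply: filterS (fl e e0) => x; apply: le_lt_trans.
by rewrite distrC; have := coord_le_enorm (f x - l) i; rewrite !mxE.
Qed.

Lemma continuous_dot {T : topologicalType} {n : nat} (f g : T -> 'cV[R]_n) x :
  {for x, continuous f} -> {for x, continuous g} ->
  {for x, continuous (fun y => dot (f y) (g y))}.
Proof.
move=> /cvg_coordP fx /cvg_coordP gx; apply: cvg_sumf => i.
by apply: cvgM; [exact: fx|exact: gx].
Qed.

Lemma continuous_mulmx {T : topologicalType} {m n : nat} (A : 'M[R]_(m, n))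
    (f : T -> 'cV[R]_n) x :
  {for x, continuous f} -> {for x, continuous (fun y => A *m f y)}.
Proof.
move=> /cvg_coordP fx; apply/cvg_coordP => i.
rewrite mxE; under eq_fun do rewrite mxE.
apply: cvg_sumf => j; apply: cvgM; [exact: cvg_cst|exact: fx].
Qed.

Lemma lipschitz_continuous {m n : nat} (G : 'cV[R]_m -> 'cV[R]_n) (K : R) :
  (forall x y, enorm (G x - G y) <= K * enorm (x - y)) -> continuous G.
Proof.
move=> GK x; apply/(@cvg_enormP _ (nbhs x)) => e e0.
have /(@cvg_enormP _ (nbhs x))/(_ (e / (`|K| + 1))) : y @[y --> x] --> x by exact: cvg_id.
rewrite divr_gt0 ?ltr_wpDl// => /(_ isT); apply: filterS => y.
rewrite ltr_pdivlMr ?ltr_wpDl// => h.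
apply: le_lt_trans h; apply: (le_trans (GK _ _)).
have := enorm_ge0 (y - x); have := ler_norm K; nra.
Qed.

Lemma is_derive_coordP {n : nat} (z : R -> 'cV[R]_n) (t : R) dz :
  is_derive t 1 z dz <-> forall i, is_derive t 1 (fun s => z s i 0) (dz i 0).
Proof.
split=> [[dvz <-] i|H].
  rewrite derive_mx// mxE; apply: DeriveDef => //.
  by have /derivable_mxP := dvz; exact.
have dvz : derivable z t 1 by apply/derivable_mxP => i j; rewrite (ord1 j); case: (H i).
apply: DeriveDef => //; rewrite derive_mx//.
by apply/matrixP => i j; rewrite (ord1 j) mxE; case: (H i).
Qed.

Lemma is_derive_sum_fun {n : nat} (h : 'I_n -> R -> R) (dh : 'I_n -> R) (t : R) :
  (forall i, is_derive t 1 (h i) (dh i)) ->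
  is_derive t 1 (fun s => \sum_(i < n) h i s) (\sum_(i < n) dh i).
Proof.
move=> H; rewrite (_ : (fun s => _) = \sum_(i < n) h i); first exact: is_derive_sum.
by apply/funext => s; rewrite fct_sumE.
Qed.

Lemma is_derive_mulf (f g : R -> R) (df dg t : R) :
  is_derive t 1 f df -> is_derive t 1 g dg ->
  is_derive t 1 (fun s => f s * g s) (df * g t + f t * dg).
Proof.
move=> Hf Hg; have -> : (fun s => f s * g s) = f * g by [].
by apply: is_derive_eq; rewrite /GRing.scale/=; ring.
Qed.

Lemma is_derive_mull (k : R) (f : R -> R) (df t : R) :
  is_derive t 1 f df -> is_derive t 1 (fun s => k * f s) (k * df).
Proof. by move=> Hf; have -> : (fun s => k * f s) = k *: f by []; exact: is_deriveZ. Qed.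

Lemma is_derive_expR_linear (k t : R) :
  is_derive t 1 (fun s : R => expR (k * s)) (k * expR (k * t)).
Proof.
have D := is_derive_mull k id 1 t (is_derive_id t 1); rewrite mulr1 in D.
by rewrite mulrC; apply: (@is_derive1_comp _ expR).
Qed.

Lemma is_derive_dot {n : nat} (u v : R -> 'cV[R]_n) (t : R) du dv :
  is_derive t 1 u du -> is_derive t 1 v dv ->
  is_derive t 1 (fun s => dot (u s) (v s)) (dot du (v t) + dot (u t) dv).
Proof.
move=> /is_derive_coordP Hu /is_derive_coordP Hv.
rewrite /dot -big_split/=; apply: is_derive_sum_fun => i.
exact: is_derive_mulf.
Qed.

Lemma is_derive_mulmx {m n : nat} (A : 'M[R]_(m, n)) (u : R -> 'cV[R]_n) (t : R) du :
  is_derive t 1 u du -> is_derive t 1 (fun s => A *m u s) (A *m du).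
Proof.
move=> /is_derive_coordP Hu; apply/is_derive_coordP => i.
rewrite mxE (_ : (fun s => _) = fun s => \sum_j A i j * u s j 0); last first.
  by apply/funext => s; rewrite mxE.
exact: is_derive_sum_fun.
Qed.

Lemma is_derive_comp_curve {n : nat} (z : R -> 'cV[R]_n) (s : R -> R) (t : R) dz ds :
  is_derive (s t) 1 z dz -> is_derive t 1 s ds ->
  is_derive t 1 (fun r => z (s r)) (ds *: dz).
Proof.
move=> /is_derive_coordP Hz Hs; apply/is_derive_coordP => i.
rewrite mxE mulrC; exact: (@is_derive1_comp _ (fun r => z r i 0)).
Qed.

Lemma is_derive_continuous {V : normedModType R} (f : R -> V) (t : R) df :
  is_derive t 1 f df -> {for t, continuous f}.
Proof. by case=> /derivable1_diffP/differentiable_continuous. Qed.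

(** Continuity is two-sided even at [a] and [b]; this is why curves on the half-line are extended to
    negative times below. *)
Lemma derive_le0_nincr (f f' : R -> R) (a b : R) : a <= b ->
  (forall t : R, a <= t <= b -> {for t, continuous f}) ->
  (forall t : R, a < t < b -> is_derive t 1 f (f' t) /\ f' t <= 0) -> f b <= f a.
Proof.
move=> ab cf df.
have H (t : R) : t \in `]a, b[%R -> derivable f t 1 /\ f^`()%classic t <= 0.
  by rewrite in_itv/= => /df[[? dfE] ?]; rewrite derive1E dfE.
apply: (@ler0_derive1_le_cc _ f a b) => //.
- by move=> t /H[].
- by move=> t /H[].
- by apply: continuous_in_subspaceT => t; rewrite inE/= in_itv/= => /cf.
- by rewrite in_itv/= ab lexx.
- by rewrite in_itv/= ab lexx.
Qed.

Lemma derive_gt0_incr (f f' : R -> R) (a b : R) : a < b ->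
  (forall t : R, a <= t <= b -> {for t, continuous f}) ->
  (forall t : R, a < t < b -> is_derive t 1 f (f' t) /\ 0 < f' t) -> f a < f b.
Proof.
move=> ab cf df.
have H (t : R) : t \in `]a, b[%R -> derivable f t 1 /\ 0 < f^`()%classic t.
  by rewrite in_itv/= => /df[[? dfE] ?]; rewrite derive1E dfE.
apply: (@gtr0_derive1_lt_cc _ f a b) => //.
- by move=> t /H[].
- by move=> t /H[].
- by apply: continuous_in_subspaceT => t; rewrite inE/= in_itv/= => /cf.
- by rewrite in_itv/= lexx ltW.
- by rewrite in_itv/= lexx ltW.
Qed.

Lemma derive0_cst (f : R -> R) (a b : R) : a <= b ->
  (forall t : R, a <= t <= b -> {for t, continuous f}) ->
  (forall t : R, a < t < b -> is_derive t 1 f 0) -> f b = f a.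
Proof.
move=> ab cf df; apply/eqP; rewrite eq_le; apply/andP; split.
  by apply: (@derive_le0_nincr f (fun=> 0)) => // t /df.
rewrite -lerN2; apply: (@derive_le0_nincr (\- f) (fun=> 0)) => // t tab.
  by apply: continuousN; exact: cf.
by split => //; have := df t tab => h; apply: is_derive_eq; rewrite oppr0.
Qed.

(** Both [f - B] and [- f - B] are nonincreasing. The majorant [B] is exponential in the Picard
    estimates and linear at the settling time. *)
Lemma derive_bound (f f' B B' : R -> R) (a b : R) : a <= b ->
  (forall t : R, a <= t <= b -> {for t, continuous f} /\ {for t, continuous B}) ->
  (forall t : R, a < t < b ->
    [/\ is_derive t 1 f (f' t), is_derive t 1 B (B' t) & `|f' t| <= B' t]) ->
  `|f b - f a| <= B b - B a.
Proof.
move=> ab c d.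
have h1 : f b - B b <= f a - B a.
  apply: (@derive_le0_nincr (f \- B) (f' \- B')) => // t tab.
    by have [cf cB] := c t tab; exact: continuousB.
  have [df dB] := d t tab; rewrite ler_norml => /andP[_ h].
  by split; [exact: is_deriveB|rewrite /= subr_le0].
have h2 : - f b - B b <= - f a - B a.
  apply: (@derive_le0_nincr (- f - B) (fun t => - f' t - B' t)) => // t tab.
    by have [cf cB] := c t tab; apply: continuousB => //; exact: continuousN.
  have [df dB] := d t tab; rewrite ler_norml => /andP[h _].
  split; [exact: is_deriveB|lra].
by rewrite ler_norml; lra.
Qed.

(** Integrating from -1 makes 0 an interior point, so that the derivative at 0 is two-sided. *)
Lemma primitive_exists (h : R -> R) : continuous h ->
  exists2 H : R -> R, H 0 = 0 & forall t : R, -1 < t -> is_derive t 1 H (h t).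
Proof.
move=> ch.
pose H0 (x : R) := (\int[lebesgue_measure]_(s in `[-1, x]) h s)%R.
have dH0 (t : R) : -1 < t -> is_derive t 1 H0 (h t).
  move=> t1.
  have [] := @continuous_FTC1_closed R h (-1) t (t + 1) _ _ t1 (ch t).
  - by rewrite ltrDl.
  - apply: continuous_compact_integrable; first exact: segment_compact.
    by apply: continuous_subspaceT => x; exact: ch.
  by move=> D; rewrite derive1E => DE; apply: DeriveDef.
exists (fun t => H0 t - H0 0) => [|t t1]; first by rewrite subrr.
have D := dH0 t t1.
rewrite (_ : (fun t => _) = H0 - cst (H0 0))//.
by apply: is_derive_eq; rewrite subr0.
Qed.

(** With [c k = M / (1 - r) * r ^+ k], the intervals of centre [u k] and radius [c k] are nested
    because [c k = M * r ^+ k + c k.+1]. The supremum of their left ends lies in all of them, which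
    also gives the rate. *)
Lemma geometric_cvg (u : nat -> R) (M r : R) : 0 <= r < 1 ->
  (forall k, `|u k.+1 - u k| <= M * r ^+ k) ->
  exists l, forall k, `|l - u k| <= M / (1 - r) * r ^+ k.
Proof.
move=> /andP[r0 r1] H.
have s0 : 0 < 1 - r by rewrite subr_gt0.
have M0 : 0 <= M by have := H 0; rewrite expr0 mulr1; exact: le_trans.
have rec k : M / (1 - r) * r ^+ k = M * r ^+ k + M / (1 - r) * r ^+ k.+1.
  by rewrite exprS; field; rewrite gt_eqF.
pose c k := M / (1 - r) * r ^+ k.
have c0 k : 0 <= c k by rewrite mulr_ge0 ?exprn_ge0 ?divr_ge0 ?(ltW s0).
have am : nondecreasing_seq (fun k => u k - c k).
  apply/nondecreasing_seqP => k; have := H k.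
  by rewrite ler_norml /c (rec k) => /andP[? _]; lra.
have bm : nonincreasing_seq (fun k => u k + c k).
  apply/nonincreasing_seqP => k; have := H k.
  by rewrite ler_norml /c (rec k) => /andP[_ ?]; lra.
have ab k m : u k - c k <= u m + c m.
  have := am _ _ (leq_maxl k m); have := bm _ _ (leq_maxr k m).
  by have := c0 (maxn k m); lra.
have ub m : ubound (range (fun k => u k - c k)) (u m + c m).
  by move=> _ [k _ <-]; exact: ab.
exists (sup (range (fun k => u k - c k))) => k.
have h1 : u k - c k <= sup (range (fun k => u k - c k)).
  by apply: ub_le_sup; [exists (u k + c k); exact: ub|exists k].
have h2 : sup (range (fun k => u k - c k)) <= u k + c k.
  by apply: ge_sup; [exists (u k - c k), k|exact: ub].
by rewrite ler_norml /c in h1 h2 *; lra.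
Qed.

End Calculus.

(** * Changes of time *)

Section Clock.
Context {R : realType}.

Lemma maxr0_continuous : continuous (fun t : R => Num.max t 0).
Proof. by move=> t; apply: continuous_max; [exact: cvg_id|exact: cvg_cst]. Qed.

(** Extending by the value at 0 turns continuity within the half-line into two-sided continuity. *)
Lemma continuous_max0 {n : nat} (z : R -> 'cV[R]_n) :
  {within `[0, +oo[%classic, continuous z} ->
  continuous (fun t : R => z (Num.max t 0)).
Proof.
move=> /subspace_continuousP zc t.
have m0 : `[0, +oo[%classic (Num.max t 0) by rewrite /= in_itv/= andbT le_max lexx orbT.
apply: (@cvg_comp _ _ _ (fun s : R => Num.max s 0) z _ _ _ _ (zc _ m0)).
move=> U HU.
have H : \forall s \near t, `[0, +oo[%classic (Num.max s 0) -> U (Num.max s 0).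
  exact: maxr0_continuous t _ HU.
change (\forall s \near t, U (Num.max s 0)); apply: filterS H => s; apply.
by rewrite /= in_itv/= andbT le_max lexx orbT.
Qed.

(** Serves at the settling time, where a bound [e * |t - x|] for every [e > 0] is what is at
    hand. *)
Lemma is_derive0_squeeze (f : R -> R) (x : R) :
  (forall e, 0 < e -> \forall t \near x, `|f t - f x| <= e * `|t - x|) ->
  is_derive x 1 f 0.
Proof.
move=> H.
have C : h^-1 *: (f (h *: 1 + x) - f x) @[h --> 0^'] --> (0 : R).
  apply/cvgrPdist_le => e e0.
  have /nbhs_ballP[d /= d0 dP] := H e e0.
  near=> h.
  have h0 : h != 0 by near: h; exact: nbhs_dnbhs_neq.
  rewrite sub0r normrN normrZ normfV ler_pdivrMl ?normr_gt0// mulrC.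
  have -> : `|h| = `|h *: 1 + x - x| by rewrite addrK /GRing.scale/= mulr1.
  apply: dP; rewrite /ball/= opprD addrCA subrr addr0 normrN /GRing.scale/= mulr1.
  by near: h; exact: dnbhs0_lt.
apply: DeriveDef; first by apply/cvg_ex; exists 0.
exact/cvg_lim.
Unshelve. all: by end_near. Qed.

(** The increasing [th] maps [[0, +oo[] onto [[0, tau[], where [tau] is the supremum of its values
    and is not attained. *)
Lemma bounded_clock_inverse (th dth : R -> R) (A : R) : th 0 = 0 ->
  (forall t : R, -1 < t -> is_derive t 1 th (dth t)) ->
  (forall t : R, -1 < t -> 0 < dth t) ->
  (forall t : R, 0 <= t -> th t <= A) ->
  exists tau s, [/\ 0 < tau <= A, forall r : R, 0 <= r -> th r < tau,
    forall t, 0 <= t < tau -> 0 <= s t /\ th (s t) = t &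
    (forall r t : R, 0 <= r -> th r <= t < tau -> r <= s t) /\
    forall t : R, 0 <= t < tau -> is_derive t 1 s (dth (s t))^-1].
Proof.
move=> th0 dP dth0 thA.
have lt1 (t : R) : 0 <= t -> -1 < t by move=> t0; rewrite (lt_le_trans _ t0)// ltrN10.
have incr (x y : R) : -1 < x -> x < y -> th x < th y.
  move=> x1 xy; apply: (@derive_gt0_incr _ th dth) => // t /andP[xt _].
    by apply: is_derive_continuous (dP t _); exact: lt_le_trans xt.
  by split; [apply: dP|apply: dth0]; exact: lt_trans xt.
have incrE (x y : R) : -1 < x -> -1 < y -> (th x <= th y) = (x <= y).
  move=> x1 y1; have [xy|yx|->] := ltgtP x y; last by rewrite lexx.
    by rewrite ltW// incr.
  by apply/negbTE; rewrite -ltNge incr.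
pose S := [set th r | r in [set r | 0 <= r]].
have S_ub : has_ubound S by exists A => _ [r r0 <-]; exact: thA.
have S_sup : has_sup S by split=> //; exists (th 0); exists 0 => //=.
pose tau := sup S.
have th_tau (r : R) : 0 <= r -> th r < tau.
  move=> r0; have r1 : r < r + 1 by rewrite ltrDl.
  apply: lt_le_trans (incr r (r + 1) (lt1 _ r0) r1) _.
  by apply: ub_le_sup => //; exists (r + 1) => //=; rewrite addr_ge0.
have tau_gt0 : 0 < tau by rewrite -th0 th_tau.
have inj (x y : R) : -1 < x -> -1 < y -> th x = th y -> x = y.
  move=> x1 y1 e; have [xy|yx|//] := ltgtP x y.
    by have := incr _ _ x1 xy; rewrite e ltxx.
  by have := incr _ _ y1 yx; rewrite e ltxx.
have surj (t : R) : 0 <= t < tau -> exists2 r : R, 0 <= r & th r = t.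
  move=> /andP[t0 tt].
  have [_ [r /= r0 <-] tr] : exists2 x, S x & t < x.
    have tt0 : 0 < tau - t by rewrite subr_gt0.
    by have [x Sx xt] := sup_adherent tt0 S_sup; exists x => //; move: xt; rewrite -/tau subKr.
  have [||x] := @IVT _ th 0 r t r0.
  - apply: continuous_in_subspaceT => x; rewrite inE/= in_itv/= => /andP[x0 _].
    by apply: is_derive_continuous (dP x _); exact: lt1.
  - by rewrite th0 ge_min t0/= le_max (ltW tr) orbT.
  - by rewrite in_itv/= => /andP[x0 _] <-; exists x.
(* Inverting on [r > -1], not only on [r >= 0], makes [s] a left inverse of [th] around 0 as well,
   as a two-sided derivative of [s] at 0 requires. The default 0 is met only off the image of
   [th]. *)
pose s (t : R) := xget 0 [set r : R | -1 < r /\ th r = t].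
have sP (r : R) : -1 < r -> s (th r) = r.
  move=> r1; have [h1 h2] : [set x : R | -1 < x /\ th x = th r] (s (th r)).
    by apply: xgetPex; exists r.
  exact: inj h2.
have sP' (t : R) : 0 <= t < tau -> 0 <= s t /\ th (s t) = t.
  by move=> /surj[r r0 <-]; rewrite sP ?lt1.
exists tau, s; split => //.
  rewrite tau_gt0/=; apply: ge_sup; first by exists (th 0), 0 => //=.
  by move=> _ [r r0 <-]; exact: thA.
split=> [r t r0 /andP[rt tt]|t t0].
  have t0 : 0 <= t by apply: le_trans rt; rewrite -th0 incrE ?lt1.
  have t0t : 0 <= t < tau by rewrite t0.
  have [s0 st] := sP' t t0t.
  by rewrite -incrE ?lt1// st.
have [s0 st] := sP' t t0.
rewrite -{1}st; apply: (@is_derive_inverse _ th).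
- near=> x; apply: sP; near: x; apply: lt_nbhsr; exact: lt1.
- near=> x; apply: is_derive_continuous (dP x _).
  by near: x; apply: lt_nbhsr; exact: lt1.
- by apply: dP; exact: lt1.
- by rewrite gt_eqF// dth0// lt1.
Unshelve. all: by end_near. Qed.

End Clock.

(** * Global flow of a Lipschitz field *)

Section Picard.
Context {R : realType}.

Lemma geometric_cvg_vec {n : nat} (u : nat -> 'cV[R]_n) (M r : R) : 0 <= r < 1 ->
  (forall k i, `|u k.+1 i 0 - u k i 0| <= M * r ^+ k) ->
  exists l : 'cV[R]_n, forall k i, `|l i 0 - u k i 0| <= M / (1 - r) * r ^+ k.
Proof.
move=> r01 H.
have /choice[l lP] i := geometric_cvg (fun k => u k i 0) M r r01 (H^~ i).
by exists (\col_i l i) => k i; rewrite mxE.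
Qed.

Lemma le_geometric_le0 (x C r : R) : 0 <= r < 1 ->
  (forall k, x <= C * r ^+ k) -> x <= 0.
Proof.
move=> /andP[r0 r1] H.
have cv : C * r ^+ k @[k --> \oo] --> C * 0.
  by apply: cvgM; [exact: cvg_cst|apply: cvg_expr; rewrite ger0_norm].
rewrite -(mulr0 C).
apply: (@ler_cvg_to _ \oo _ _ (fun=> x) (fun k => C * r ^+ k)) => //; last exact: nearW.
exact: cvg_cst.
Qed.

Lemma primitive_exists_vec {n : nat} (h : R -> 'cV[R]_n) (z0 : 'cV[R]_n) :
  continuous h -> exists2 H : R -> 'cV[R]_n, H 0 = z0 &
    forall t : R, -1 < t -> is_derive t 1 H (h t).
Proof.
move=> ch.
have chi i : continuous (fun s => h s i 0).
  by move=> s; have /(@cvg_coordP _ _ (nbhs s)) := ch s; exact.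
have /choice[H HP] (i : 'I_n) : exists Hi : R -> R,
    Hi 0 = 0 /\ forall t : R, -1 < t -> is_derive t 1 Hi (h t i 0).
  by have [Hi ? ?] := primitive_exists _ (chi i); exists Hi.
exists (fun t => \col_i (z0 i 0 + H i t)) => [|t t1].
  by apply/matrixP => i j; rewrite (ord1 j) mxE (HP i).1 addr0.
apply/is_derive_coordP => i.
have D := (HP i).2 t t1.
rewrite (_ : (fun s => _) = cst (z0 i 0) + H i); last first.
  by apply/funext => s; rewrite mxE.
by apply: is_derive_eq; rewrite add0r.
Qed.

Context {N : nat} (F : 'cV[R]_N -> 'cV[R]_N) (K : R).
Hypothesis F_lip : forall x y, enorm (F x - F y) <= K * enorm (x - y).
Variable z0 : 'cV[R]_N.

(** A Lipschitz constant for coordinatewise estimates: [N] comes from bounding [enorm] by the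
    largest coordinate, and the 1 ensures positivity. *)
Let L := `|K| * N%:R + 1.

Let L_gt0 : 0 < L.
Proof. by rewrite /L ltr_wpDl// mulr_ge0. Qed.

Lemma enorm_le_coord {n : nat} (u : 'cV[R]_n) (e : R) :
  (forall i, `|u i 0| <= e) -> enorm u <= n%:R * e.
Proof.
move=> ue; have [n0|n0] := posnP n.
  subst n; rewrite mul0r le_eqVlt; apply/orP; left; rewrite enorm_eq0.
  by apply/eqP/matrixP => -[].
have e0 : 0 <= e by apply: le_trans (ue (Ordinal n0)).
rewrite -(@ler_pXn2r _ 2)// ?nnegrE ?mulr_ge0 ?enorm_ge0// -dot_enorm.
apply: (@le_trans _ _ (\sum_(i < n) e ^+ 2)).
  by apply: ler_sum => i _; rewrite -expr2 -real_normK ?num_real// ler_pXn2r ?nnegrE.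
rewrite sumr_const card_ord -[leLHS]mulr_natl exprMn ler_wpM2r ?sqr_ge0//.
by rewrite -natrX ler_nat -mulnn leq_pmulr.
Qed.

Let F_coord (x y : 'cV[R]_N) (e : R) i : (forall j, `|x j 0 - y j 0| <= e) ->
  `|F x i 0 - F y i 0| <= L * e.
Proof.
move=> xy.
have e0 : 0 <= e by apply: le_trans (xy i).
have h : enorm (x - y) <= N%:R * e by apply: enorm_le_coord => j; rewrite !mxE.
have := coord_le_enorm (F x - F y) i; rewrite !mxE => /le_trans; apply.
apply: (le_trans (F_lip _ _)).
have h0 := enorm_ge0 (x - y).
apply: (@le_trans _ _ (`|K| * (N%:R * e))).
  apply: (@le_trans _ _ (`|K| * enorm (x - y))); last by rewrite ler_wpM2l.
  by rewrite ler_wpM2r// ler_norm.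
by rewrite mulrA /L mulrDl mul1r lerDl.
Qed.

Let F_cont : continuous F. Proof. exact: lipschitz_continuous F_lip. Qed.

(** [w'] is a Picard iterate of [w]; freezing the integrand at time 0 for negative times gives
    two-sided derivatives at 0. *)
Let good (w w' : R -> 'cV[R]_N) := w' 0 = z0 /\
  forall t : R, -1 < t -> is_derive t 1 w' (F (w (Num.max t 0))).

Let step_exists (w : R -> 'cV[R]_N) :
  (forall t : R, 0 <= t -> {for t, continuous w}) -> exists w', good w w'.
Proof.
move=> wc.
have [|H H0 HP] := primitive_exists_vec (fun t => F (w (Num.max t 0))) z0.
  move=> t; apply: (@continuous_compf _ _ _ (fun s : R => w (Num.max s 0)) F); last exact: F_cont.
  apply: (@continuous_compf _ _ _ (fun s : R => Num.max s 0) w); first exact: maxr0_continuous.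
  by apply: wc; rewrite le_max lexx orbT.
by exists H; split.
Qed.

Let good_cont w w' : good w w' -> forall t : R, -1 < t -> {for t, continuous w'}.
Proof. by move=> [_ H] t /H; exact: is_derive_continuous. Qed.

Let is_derive_exp (M a t : R) :
  is_derive t 1 (fun s : R => M * expR (a * s)) (M * (a * expR (a * t))).
Proof. exact/is_derive_mull/is_derive_expR_linear. Qed.

(* The weight [expR (2 * L * t)] makes the Picard operator a 1/2-contraction on
   the whole half-line. *)
Let picard_step (w1 w2 w1' w2' : R -> 'cV[R]_N) (M : R) : good w1 w1' -> good w2 w2' ->
  (forall t i, 0 <= t -> `|w1 t i 0 - w2 t i 0| <= M * expR (2 * L * t)) ->
  forall t i, 0 <= t -> `|w1' t i 0 - w2' t i 0| <= M / 2 * expR (2 * L * t).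
Proof.
move=> g1 g2 H t i t0.
have M0 : 0 <= M.
  by have := H 0 i (lexx _); rewrite mulr0 expR0 mulr1; exact: le_trans.
have cc s : 0 <= s <= t -> -1 < s by move=> /andP[s0 _]; rewrite (lt_le_trans _ s0)// ltrN10.
have := @derive_bound R (fun s => w1' s i 0 - w2' s i 0)
  (fun s => F (w1 (Num.max s 0)) i 0 - F (w2 (Num.max s 0)) i 0)
  (fun s => M / 2 * expR (2 * L * s)) (fun s => M / 2 * (2 * L * expR (2 * L * s))) 0 t t0.
rewrite g1.1 g2.1 subrr subr0 mulr0 expR0 mulr1 => h.
apply: (@le_trans _ _ (M / 2 * expR (2 * L * t) - M / 2)); last first.
  by rewrite gerBl divr_ge0.
apply: h => s s0t.
  have s1 := cc s s0t; split; last exact: is_derive_continuous (is_derive_exp _ _ _).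
  have /(@cvg_coordP _ _ (nbhs s)) h1 := good_cont _ _ g1 s s1.
  have /(@cvg_coordP _ _ (nbhs s)) h2 := good_cont _ _ g2 s s1.
  by apply: cvgB; [exact: h1|exact: h2].
have /andP[s0 st] := s0t.
have s1 : -1 < s by rewrite (lt_trans _ s0)// ltrN10.
split; last first.
- rewrite (_ : M / 2 * (2 * L * expR (2 * L * s)) = L * (M * expR (2 * L * s))); last by field.
  by apply: F_coord => j; rewrite (max_l (ltW s0)); apply: H; exact: ltW.
- exact: is_derive_exp.
have /is_derive_coordP/(_ i) h1 := g1.2 s s1.
have /is_derive_coordP/(_ i) h2 := g2.2 s s1.
exact: is_deriveB.
Qed.

(** The Picard iterates converge geometrically at each time, with constants locally uniform in time.
    Their limit [v] is thus continuous, and one more Picard step [W] can be applied to it. *)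
Lemma flow_exists : exists2 w : R -> 'cV[R]_N, w 0 = z0 &
  forall t : R, -1 < t -> is_derive t 1 w (F (w (Num.max t 0))).
Proof.
have /choice[step stepP] (w : R -> 'cV[R]_N) : exists w' : R -> 'cV[R]_N,
    (forall t : R, 0 <= t -> {for t, continuous w}) -> good w w'.
  have [wc|nwc] := pselect (forall t : R, 0 <= t -> {for t, continuous w}).
    by have [w' gw] := step_exists w wc; exists w'.
  by exists w.
pose u k := iter k step (fun=> z0).
have uc k (t : R) : 0 <= t -> {for t, continuous (u k)}.
  elim: k t => [|k IH] t t0; first exact: cvg_cst.
  by apply: (good_cont (u k)); [exact: stepP|rewrite (lt_le_trans _ t0)// ltrN10].
have ug k : good (u k) (u k.+1) by apply: stepP => t; exact: uc.
(* The derivative of [M * expR (2 * L * t)] is then at least [enorm (F z0)], which bounds the speed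
   of the first iterate. *)
pose M := enorm (F z0) / (2 * L).
have M0 : 0 <= M by rewrite divr_ge0 ?enorm_ge0// mulr_ge0// ltW.
have half01 : 0 <= (2^-1 : R) < 1 by lra.
have ub k t i : 0 <= t -> `|u k.+1 t i 0 - u k t i 0| <= M * expR (2 * L * t) * 2^-1 ^+ k.
  elim: k t i => [|k IH] t i t0; last first.
    rewrite (_ : M * _ * _ = M * 2^-1 ^+ k / 2 * expR (2 * L * t)); last first.
      by rewrite exprS; ring.
    apply: (picard_step (u k.+1) (u k) (u k.+2) (u k.+1)) => // s j s0.
    by rewrite mulrAC; exact: IH.
  rewrite expr0 mulr1.
  have := @derive_bound R (fun s => u 1%N s i 0) (fun s => F z0 i 0)
    (fun s => M * expR (2 * L * s)) (fun s => M * (2 * L * expR (2 * L * s))) 0 t t0.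
  rewrite (ug 0%N).1 mulr0 expR0 mulr1 => h.
  apply: (@le_trans _ _ (M * expR (2 * L * t) - M)); last by rewrite gerBl.
  apply: h => s /andP[s0 st].
    split; last exact: is_derive_continuous (is_derive_exp _ _ _).
    by have /(@cvg_coordP _ _ (nbhs s)) := uc 1%N s s0; exact.
  have s1 : -1 < s by rewrite (lt_trans _ s0)// ltrN10.
  split; last first.
  - rewrite mulrA /M divfK ?gt_eqF ?mulr_gt0//.
    apply: (le_trans (coord_le_enorm _ _)); rewrite ler_peMr ?enorm_ge0//.
    by rewrite -expR0 ler_expR mulr_ge0 ?mulr_ge0// ltW.
  - exact: is_derive_exp.
  by have /is_derive_coordP/(_ i) := (ug 0%N).2 s s1.
have /choice[v0 v0P] (t : R) : exists l : 'cV[R]_N, 0 <= t ->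
    forall k i, `|l i 0 - u k t i 0| <= 2 * M * expR (2 * L * t) * 2^-1 ^+ k.
  have [t0|t0] := leP 0 t; last by exists 0.
  have [l lP] := @geometric_cvg_vec _ (fun k => u k t) (M * expR (2 * L * t)) 2^-1 half01
    (fun k i => ub k t i t0).
  exists l => _ k i; apply: (le_trans (lP k i)).
  rewrite le_eqVlt; apply/orP; left; apply/eqP.
  by field.
have vc (t : R) : {for t, continuous (fun s : R => v0 (Num.max s 0))}.
  apply/(@cvg_coordP _ _ (nbhs t)) => i; apply/cvgrPdist_lt => e e0.
  pose C := 2 * M * expR (2 * L * (`|t| + 1)).
  have C0 : 0 <= C by apply: mulr_ge0; [exact: mulr_ge0|exact: expR_ge0].
  have [k kP] : exists k, C * 2^-1 ^+ k < e / 3.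
    apply: contrapT => /forallNP nk.
    suff : e / 3 <= 0 by lra.
    apply: (@le_geometric_le0 _ C 2^-1) => // k.
    by rewrite leNgt; apply/negP; exact: nk.
  have vu (s : R) : `|s - t| < 1 ->
      `|v0 (Num.max s 0) i 0 - u k (Num.max s 0) i 0| < e / 3.
    move=> st; apply: le_lt_trans kP.
    apply: (le_trans (v0P _ _ k i)); first by rewrite le_max lexx orbT.
    rewrite ler_wpM2r ?exprn_ge0//.
    rewrite /C; apply: ler_wpM2l; first exact: mulr_ge0.
    rewrite ler_expR; apply: ler_wpM2l; first by rewrite mulr_ge0 ?(ltW L_gt0).
    rewrite ge_max addr_ge0 ?andbT//.
    by have := ler_norm t; have := ler_norm (s - t); lra.
  have uk : {for t, continuous (fun s : R => u k (Num.max s 0) i 0)}.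
    have h : {for t, continuous (fun s : R => u k (Num.max s 0))}.
      apply: (@continuous_compf _ _ _ (fun s : R => Num.max s 0) (u k)).
        exact: maxr0_continuous.
      by apply: uc; rewrite le_max lexx orbT.
    by have /(@cvg_coordP _ _ (nbhs t)) := h; exact.
  have /cvgrPdist_lt/(_ (e / 3)) := uk.
  rewrite divr_gt0// => /(_ isT) near1.
  have near2 : \forall s \near t, `|s - t| < 1.
    have /cvgrPdist_lt/(_ 1 ltr01) : s @[s --> t] --> t by exact: cvg_id.
    by apply: filterS => s; rewrite distrC.
  near=> s.
  have h1 := vu s; have h2 := vu t; rewrite subrr normr0 in h2.
  have {h1} h1 : `|v0 (Num.max s 0) i 0 - u k (Num.max s 0) i 0| < e / 3.
    by apply: h1; near: s.
  have {h2} := h2 ltr01.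
  have h3 : `|u k (Num.max t 0) i 0 - u k (Num.max s 0) i 0| < e / 3 by near: s.
  by move: h1 h3; rewrite !ltr_norml => /andP[? ?] /andP[? ?] /andP[? ?]; lra.
pose v (s : R) := v0 (Num.max s 0).
have [|W gW] := step_exists v; first by move=> t _; exact: vc.
have vP k (t : R) i : 0 <= t -> `|v t i 0 - u k t i 0| <= (2 * M * 2^-1 ^+ k) * expR (2 * L * t).
  move=> t0; rewrite /v max_l//; apply: (le_trans (v0P t t0 k i)).
  by rewrite mulrAC.
(* Both curves are within a geometrically small distance of the same iterate [u k.+1], for every
   [k]. *)
have Wv (t : R) : 0 <= t -> W t = v t.
  move=> t0; apply/matrixP => i j; rewrite (ord1 j).
  apply/eqP; rewrite -subr_eq0 -normr_eq0 eq_le normr_ge0 andbT.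
  apply: (@le_geometric_le0 _ (2 * M * expR (2 * L * t)) 2^-1) => // k.
  have h1 := picard_step v (u k) W (u k.+1) _ gW (ug k) (fun s j s0 => vP k s j s0) t i t0.
  have h2 := vP k.+1 t i t0; rewrite exprS in h2.
  rewrite -(subrKA (u k.+1 t i 0)); apply: (le_trans (ler_normD _ _)).
  rewrite (distrC (u _ _ _ _)); apply: (le_trans (lerD h1 h2)).
  by rewrite le_eqVlt; apply/orP; left; apply/eqP; field.
exists W; first exact: gW.1.
move=> t t1; rewrite Wv ?le_max ?lexx ?orbT//.
have := gW.2 t t1; rewrite {1 2}/v.
by rewrite (@max_l _ _ (Num.max t 0))// le_max lexx orbT.
Unshelve. all: by end_near. Qed.

End Picard.

(** * Rescaled strongly monotone fields *)

Section StronglyMonotone.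
Context {R : realType} {N : nat} (F : 'cV[R]_N -> 'cV[R]_N) (P : 'M[R]_N).
Context (K a b c : R).
Hypotheses (K_gt0 : 0 < K) (a_gt0 : 0 < a) (b_gt0 : 0 < b) (c_gt0 : 0 < c).
Hypothesis P_sym : P^T = P.
Hypothesis P_ge : forall u : 'cV[R]_N, a * dot u u <= dot u (P *m u).
Hypothesis P_le : forall u : 'cV[R]_N, dot u (P *m u) <= b * dot u u.
Hypothesis F_lip : forall x y, enorm (F x - F y) <= K * enorm (x - y).
Hypothesis F_mono : forall x y,
  dot (x - y) (P *m (F x - F y)) <= - c * dot (x - y) (x - y).

Let V (u : 'cV[R]_N) : R := dot u (P *m u).

Let PC u v : dot u (P *m v) = dot v (P *m u).
Proof. by rewrite dotC dot_adj P_sym. Qed.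

Let V_ge0 u : 0 <= V u.
Proof. by apply: le_trans (P_ge u); rewrite mulr_ge0 ?dot_ge0// ltW. Qed.

Let V_eq0 u : (V u == 0) = (u == 0).
Proof.
apply/eqP/eqP => [u0|->]; last by rewrite /V dot0l.
have := P_ge u; rewrite -/(V u) u0 pmulr_rle0// => h.
by apply/eqP; rewrite -dot_eq0 eq_le h dot_ge0.
Qed.

Let V_gt0 u : (0 < V u) = (u != 0).
Proof. by rewrite lt_def V_eq0 V_ge0 andbT. Qed.

Let lip2 x y : dot (F x - F y) (F x - F y) <= K ^+ 2 * dot (x - y) (x - y).
Proof.
rewrite !dot_enorm -exprMn ler_pXn2r// nnegrE ?enorm_ge0//.
by rewrite mulr_ge0 ?enorm_ge0// ltW.
Qed.

Let VD u v k : V (u + k *: v) = V u + 2 * k * dot u (P *m v) + k ^+ 2 * V v.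
Proof.
rewrite /V mulmxDr -scalemxAr dotDl !dotDr !dotZl !dotZr (PC v u); ring.
Qed.

Lemma strongly_monotone_zero : exists zs, F zs = 0.
Proof.
(* The quadratic term of the expansion is at most [e ^+ 2 * b * K ^+ 2 * D = e * c * D], half of the
   linear gain [2 * e * c * D]. *)
pose e := c / (b * K ^+ 2).
have K2 : 0 < K ^+ 2 by rewrite exprn_gt0.
have e0 : 0 < e by rewrite divr_gt0// mulr_gt0.
(* The maximum makes [q] a nonnegative ratio without comparing [c], [b] and [K]. *)
pose q := Num.max 0 (1 - e * c / b).
have q0 : 0 <= q by rewrite le_max lexx.
have q1 : q < 1 by rewrite gt_max ltr01/= gtrBl divr_gt0// mulr_gt0.
pose Phi z := z + e *: F z.
have Phi_contr x y : V (Phi x - Phi y) <= q * V (x - y).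
  have -> : Phi x - Phi y = (x - y) + e *: (F x - F y).
    by rewrite /Phi scalerBr opprD addrACA.
  rewrite VD; have h1 := F_mono x y; have h2 := P_le (F x - F y).
  have h3 := lip2 x y; have h4 := P_le (x - y).
  set D := dot (x - y) (x - y) in h1 h3 h4 *.
  have h5 : e ^+ 2 * V (F x - F y) <= e * c * D.
    apply: (@le_trans _ _ (e ^+ 2 * (b * (K ^+ 2 * D)))).
      by rewrite ler_wpM2l ?sqr_ge0// (le_trans h2)// ler_wpM2l// ltW.
    rewrite le_eqVlt; apply/orP; left; apply/eqP; rewrite /e; field.
    by rewrite !gt_eqF.
  have h6 : 2 * e * dot (x - y) (P *m (F x - F y)) <= - 2 * e * c * D.
    by have := ler_wpM2l (ltW e0) h1; lra.
  apply: (@le_trans _ _ ((1 - e * c / b) * V (x - y))); last first.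
    by rewrite ler_wpM2r// le_max lexx orbT.
  have h7 : e * c / b * V (x - y) <= e * c * D.
    rewrite [X in _ <= X](_ : _ = e * c / b * (b * D)); last by field; rewrite gt_eqF.
    by apply: ler_wpM2l; [exact: ltW (divr_gt0 (mulr_gt0 e0 c_gt0) b_gt0)|exact: h4].
  by lra.
pose u k := iter k Phi 0.
(* [V] is quadratic, so distances contract by the square root of its ratio. *)
pose r := Num.sqrt q.
have r01 : 0 <= r < 1.
  by rewrite sqrtr_ge0/= -sqrtr1 ltr_sqrt.
have rE k : r ^+ k ^+ 2 = q ^+ k.
  by rewrite -exprM mulnC exprM sqr_sqrtr.
pose C := V (u 1%N - u 0%N).
have VC k : V (u k.+1 - u k) <= C * q ^+ k.
  elim: k => [|k IH]; first by rewrite expr0 mulr1.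
  apply: (le_trans (Phi_contr _ _)).
  by rewrite exprS mulrCA ler_wpM2l.
have cauchy k i : `|u k.+1 i 0 - u k i 0| <= Num.sqrt (C / a) * r ^+ k.
  have Ca : 0 <= C / a by rewrite divr_ge0 ?V_ge0// ltW.
  rewrite -(@ler_pXn2r _ 2)// ?nnegrE ?mulr_ge0 ?sqrtr_ge0 ?exprn_ge0 ?sqrtr_ge0//.
  rewrite real_normK ?num_real// exprMn rE sqr_sqrtr// mulrAC ler_pdivlMr//.
  have := coord_sqr_le_dot (u k.+1 - u k) i; rewrite !mxE => h.
  apply: le_trans (VC k); apply: le_trans (P_ge _).
  by rewrite mulrC ler_wpM2l// ltW.
have [zs zsP] := geometric_cvg_vec _ _ _ r01 cauchy.
exists zs.
have cu : u k @[k --> \oo] --> zs.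
  apply/cvg_coordP => i; apply/cvgrPdist_lt => d d0.
  have : Num.sqrt (C / a) / (1 - r) * r ^+ k @[k --> \oo] --> Num.sqrt (C / a) / (1 - r) * 0.
    apply: cvgM; first exact: cvg_cst.
    by apply: cvg_expr; case/andP: r01 => ? ?; rewrite ger0_norm.
  rewrite mulr0 => /cvgrPdist_lt/(_ _ d0); apply: filterS => k.
  by rewrite sub0r normrN => /(le_lt_trans (ler_norm _)); exact: le_lt_trans.
have cPhi : Phi (u k) @[k --> \oo] --> Phi zs.
  apply: (@continuous_cvg _ _ _ \oo _ u Phi) cu.
  apply: (@cvgD _ _ _ (nbhs zs) _ id (fun z => e *: F z)); first exact: cvg_id.
  by apply: cvgZ; [exact: cvg_cst|exact: lipschitz_continuous F_lip zs].
have cS : u k.+1 @[k --> \oo] --> zs by move: cu; rewrite -(cvg_shiftS u).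
have : Phi zs = zs by exact: (cvg_unique (@norm_hausdorff _ _) cPhi cS).
move/eqP; rewrite /Phi -subr_eq0 addrAC subrr add0r scaler_eq0 gt_eqF//=.
by move/eqP.
Qed.

Lemma strongly_monotone_zero_unique x y : F x = 0 -> F y = 0 -> x = y.
Proof.
move=> Fx Fy; have := F_mono x y; rewrite Fx Fy subrr mulmx0 dot0r => h.
apply/eqP; rewrite -subr_eq0 -dot_eq0 eq_le dot_ge0 andbT.
by move: h; rewrite mulNr oppr_ge0 pmulr_rle0.
Qed.

Let is_derive_V (z : R -> 'cV[R]_N) (t : R) dz : is_derive t 1 z dz ->
  is_derive t 1 (fun s => V (z s)) (2 * dot (z t) (P *m dz)).
Proof.
move=> Hz; rewrite (_ : 2 * _ = dot dz (P *m z t) + dot (z t) (P *m dz)).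
  by apply: is_derive_dot => //; exact: is_derive_mulmx.
by rewrite (PC dz); ring.
Qed.

Let continuous_V {T : topologicalType} (f : T -> 'cV[R]_N) x :
  {for x, continuous f} -> {for x, continuous (fun y => V (f y))}.
Proof.
move=> cf; rewrite /V.
exact: (@continuous_dot _ T _ f (fun y => P *m f y) x cf (continuous_mulmx P f x cf)).
Qed.

Context (zs : 'cV[R]_N).
Hypothesis Fzs : F zs = 0.

Let mono0 z : dot (z - zs) (P *m F z) <= - c * dot (z - zs) (z - zs).
Proof. by have := F_mono z zs; rewrite Fzs subr0. Qed.

Let lip0 z : enorm (F z) <= K * enorm (z - zs).
Proof. by have := F_lip z zs; rewrite Fzs subr0. Qed.

Let lip02 z : dot (F z) (F z) <= K ^+ 2 * dot (z - zs) (z - zs).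
Proof. by have := lip2 z zs; rewrite Fzs subr0. Qed.

Let F_eq0 z : (F z == 0) = (z == zs).
Proof.
apply/eqP/eqP => [Fz|->//]; exact: strongly_monotone_zero_unique.
Qed.

Let decay_up z : 2 * dot (z - zs) (P *m F z) <= - (2 * c / b) * V (z - zs).
Proof.
have := mono0 z; have := P_le (z - zs); rewrite -/(V _).
set D := dot (z - zs) (z - zs) => h1 h2.
have h3 : V (z - zs) / b <= D by rewrite ler_pdivrMr// mulrC.
have := ler_wpM2l (ltW c_gt0) h3.
by rewrite (_ : - (2 * c / b) * V (z - zs) = - 2 * (c * (V (z - zs) / b))); [lra|ring].
Qed.

Let F_le_V z : dot (F z) (F z) <= K ^+ 2 / a * V (z - zs).
Proof.
apply: (le_trans (lip02 z)); rewrite -mulrA ler_wpM2l ?sqr_ge0//.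
by rewrite ler_pdivlMl.
Qed.

(** Expand [V (z - zs + F z) >= 0]: the energy cannot decay faster than exponentially. *)
Let decay_low z :
  - (1 + b * K ^+ 2 / a) * V (z - zs) <= 2 * dot (z - zs) (P *m F z).
Proof.
have := V_ge0 (z - zs + 1 *: F z); rewrite VD mulr1 expr1n mul1r => h1.
have h2 : V (F z) <= b * K ^+ 2 / a * V (z - zs).
  apply: (le_trans (P_le _)).
  rewrite (_ : _ / a * _ = b * (K ^+ 2 / a * V (z - zs))); last by ring.
  by apply: ler_wpM2l; [exact: ltW|exact: F_le_V].
by lra.
Qed.

(** Expand [V (F z + (c / b) *: (z - zs)) >= 0]. With the weight [c / b], strong monotonicity gives
    twice what the last square costs, leaving [c ^+ 2 / b * |z - zs|^2 <= b * |F z|^2]. *)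
Let V_le_F z : V (z - zs) <= b ^+ 3 / c ^+ 2 * dot (F z) (F z).
Proof.
have h0 := V_ge0 (F z + (c / b) *: (z - zs)); rewrite VD in h0.
have h1 := mono0 z; have h2 := P_le (z - zs); have h3 := P_le (F z).
rewrite (PC (F z)) in h0; rewrite -/(V _) in h2; rewrite -/(V _) in h3.
set D := dot (z - zs) (z - zs) in h1 h2; set Q := dot (F z) (F z) in h3 *.
set X := dot (z - zs) _ in h0 h1.
have cb : 0 < c / b by rewrite divr_gt0.
have h4 := ler_wpM2l (sqr_ge0 (c / b)) h2.
have h5 := ler_wpM2l (ltW cb) h1.
have e1 : (c / b) ^+ 2 * (b * D) = c / b * (c * D) by field; rewrite gt_eqF.
have h6 : c / b * (c * D) <= b * Q by lra.
apply: (le_trans h2).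
rewrite (_ : b * D = b ^+ 2 / c ^+ 2 * (c / b * (c * D))); last first.
  by field; rewrite !gt_eqF.
rewrite (_ : b ^+ 3 / c ^+ 2 * Q = b ^+ 2 / c ^+ 2 * (b * Q)); last first.
  by field; rewrite !gt_eqF.
by apply: ler_wpM2l => //; rewrite divr_ge0 ?sqr_ge0.
Qed.


(** * The scalar factor and its size relative to the energy *)

Context (eta1 eta2 lambda1 lambda2 : R).
Hypotheses (eta1_gt0 : 0 < eta1) (eta2_gt0 : 0 < eta2).
Hypotheses (lambda1_01 : 0 < lambda1 < 1) (lambda2_gt0 : 0 < lambda2).

Let sigma := rescaling eta1 eta2 lambda1 lambda2 F.
Let G z := sigma z *: F z.

Let sigmaE z : z != zs ->
  sigma z = eta1 * enorm (F z) `^ (- lambda1) + eta2 * enorm (F z) `^ lambda2.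
Proof. by rewrite -F_eq0 /sigma /rescaling => /negbTE ->. Qed.

Let sigma_gt0 z : z != zs -> 0 < sigma z.
Proof.
move=> zzs; have Fz : 0 < enorm (F z) by rewrite enorm_gt0 F_eq0.
by rewrite sigmaE// addr_gt0// mulr_gt0// powR_gt0.
Qed.

Let sigma_ge0 z : 0 <= sigma z.
Proof.
have [->|/sigma_gt0/ltW//] := eqVneq z zs.
by rewrite /sigma /rescaling Fzs eqxx.
Qed.

Let sigma_cont z : z != zs -> {for z, continuous sigma}.
Proof.
move=> zzs.
have Fz : 0 < enorm (F z) by rewrite enorm_gt0 F_eq0.
have Fc : {for z, continuous (fun y => enorm (F y))}.
  apply: (@continuous_compf _ _ _ F (@enorm R N)); last exact: enorm_continuous.
  exact: lipschitz_continuous F_lip z.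
pose s0 (y : 'cV[R]_N) := eta1 * enorm (F y) `^ (- lambda1) + eta2 * enorm (F y) `^ lambda2.
have s0c : {for z, continuous s0}.
  have pc r : {for z, continuous (fun y => enorm (F y) `^ r)}.
    apply: (@continuous_compf _ _ _ (fun y => enorm (F y)) (fun x => x `^ r)) => //.
    exact: is_derive_continuous (is_derive1_powR r Fz).
  apply: (@cvgD _ _ _ (nbhs z) _ (fun y => eta1 * enorm (F y) `^ (- lambda1))
    (fun y => eta2 * enorm (F y) `^ lambda2)).
    by apply: cvgM; [exact: cvg_cst|exact: pc].
  by apply: cvgM; [exact: cvg_cst|exact: pc].
have zV : \forall y \near z, s0 y = sigma y.
  have /cvgrPdist_lt/(_ _ Fz) : enorm (F y) @[y --> z] --> enorm (F z) by exact: Fc.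
  apply: filterS => y h; rewrite sigmaE//; apply/negP => /eqP yz.
  by move: h; rewrite yz Fzs [enorm 0](_ : _ = 0) ?subr0 ?ger0_norm ?ltxx ?enorm_ge0//;
    apply/eqP; rewrite enorm_eq0.
change (sigma y @[y --> z] --> sigma z); rewrite -(nbhs_singleton zV).
apply: cvg_trans s0c; apply: (@near_eq_cvg _ _ (nbhs z)).
by apply: filterS zV => y ->.
Qed.

Let p := Num.min lambda1 lambda2 / 2.

Let p_gt0 : 0 < p.
Proof. by rewrite divr_gt0// lt_min lambda2_gt0 andbT; case/andP: lambda1_01. Qed.

(** [V (z - zs)] is comparable to [|F z|^2], hence [u = V (z - zs) ^ p] to [y = |F z|^(2 p)]. Since
    [2 * p] is at most both exponents, each of [y], [1 / y] and 1 is at most the sum of the two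
    powers in [sigma]: the first power serves when [|F z| <= 1], the second otherwise. These bound
    the three terms of [(1 + u)^2 / u]. *)
Let rate_bound : exists2 C : R, 0 < C & forall z, z != zs ->
  (1 + V (z - zs) `^ p) ^+ 2 <= C * V (z - zs) `^ p * sigma z.
Proof.
have kap1 : 0 < b ^+ 3 / c ^+ 2 by rewrite divr_gt0// exprn_gt0.
have kap2 : 0 < K ^+ 2 / a by rewrite divr_gt0// exprn_gt0.
set k1 := b ^+ 3 / c ^+ 2 in kap1; set k2 := K ^+ 2 / a in kap2.
pose eta := Num.min eta1 eta2.
have eta_gt0 : 0 < eta by rewrite lt_min eta1_gt0.
have A1 : 0 < k1 `^ p by exact: powR_gt0.
have A2 : 0 < k2 `^ p by exact: powR_gt0.
exists (2 * (k1 `^ p + k2 `^ p + 1) / eta).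
  by rewrite divr_gt0// mulr_gt0// addr_gt0// addr_gt0.
move=> z zzs; rewrite sigmaE//.
have x0 : 0 < enorm (F z) by rewrite enorm_gt0 F_eq0.
have V0 : 0 < V (z - zs) by rewrite V_gt0 subr_eq0.
have hV := V_le_F z; have hF := F_le_V z.
rewrite -/k1 dot_enorm in hV; rewrite -/k2 dot_enorm in hF.
set x := enorm (F z) in x0 hV hF *; set v := V (z - zs) in V0 hV hF *.
have lE : (x ^+ 2) `^ p = x `^ (2 * p) by rewrite [RHS]powRrM powR_mulrn// ltW.
have u0 : 0 < v `^ p by exact: powR_gt0.
have y0 : 0 < x `^ (2 * p) by exact: powR_gt0.
have hu : v `^ p <= k1 `^ p * x `^ (2 * p).
  rewrite -lE -powRM ?sqr_ge0 ?(ltW kap1)//.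
  by rewrite ge0_ler_powR ?nnegrE ?(ltW p_gt0) ?(ltW V0)// mulr_ge0 ?sqr_ge0// ltW.
have hy : x `^ (2 * p) <= k2 `^ p * v `^ p.
  rewrite -lE -powRM ?(ltW V0) ?(ltW kap2)//.
  by rewrite ge0_ler_powR ?nnegrE ?(ltW p_gt0) ?sqr_ge0// mulr_ge0// ltW.
have p1 : 2 * p <= lambda1 by rewrite /p mulrC divfK ?pnatr_eq0// ge_min lexx.
have p2 : 2 * p <= lambda2 by rewrite /p mulrC divfK ?pnatr_eq0// ge_min lexx orbT.
have p0 : 0 <= 2 * p by rewrite mulr_ge0// ltW.
set u := v `^ p in u0 hu hy *; set y := x `^ (2 * p) in y0 hu hy *.
set X1 := x `^ (- lambda1); set X2 := x `^ lambda2.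
have X1_gt0 : 0 < X1 by exact: powR_gt0.
have X2_gt0 : 0 < X2 by exact: powR_gt0.
have yN : y^-1 = x `^ (- (2 * p)) by rewrite powRN.
have [hy1 hy2 h1] : [/\ y <= X1 + X2, y^-1 <= X1 + X2 & 1 <= X1 + X2].
  rewrite yN; have [x1|x1] := leP x 1.
    have x01 : 0 < x <= 1 by rewrite x0.
    have e1 : x `^ (- (2 * p)) <= X1 by rewrite /X1 ger_powR// lerN2.
    have e2 : y <= 1 by rewrite -(powRr0 x) /y ger_powR.
    have e3 : 1 <= x `^ (- (2 * p)) by rewrite -{1}(powRr0 x) ger_powR// oppr_le0.
    by split; lra.
  have e1 : y <= X2 by rewrite /y /X2 ler_powR// ltW.
  have e2 : 1 <= y by rewrite -(powRr0 x) /y ler_powR// ltW.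
  have e3 : x `^ (- (2 * p)) <= 1 by rewrite -{2}(powRr0 x) ler_powR ?oppr_le0// ltW.
  by split; lra.
have hs : eta * (X1 + X2) <= eta1 * X1 + eta2 * X2.
  by rewrite mulrDr lerD// ler_wpM2r ?(ltW X1_gt0) ?(ltW X2_gt0)// ge_min lexx ?orbT.
set S := X1 + X2 in hy1 hy2 h1 hs; set sg := eta1 * X1 + eta2 * X2 in hs *.
have hu1 : u <= k1 `^ p * S by apply: (le_trans hu); rewrite ler_wpM2l// ltW.
have hu2 : 1 <= k2 `^ p * S * u.
  rewrite mulrAC -(mulVf (lt0r_neq0 y0)) mulrC.
  by apply: ler_pM => //; rewrite ?invr_ge0 ltW.
have S0 : 0 < S by rewrite /S addr_gt0.
have final : (1 + u) ^+ 2 <= 2 * (k1 `^ p + k2 `^ p + 1) * u * S.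
  have m1 := ler_wpM2l (ltW u0) hu1; have m2 := ler_wpM2l (ltW u0) h1.
  have m3 : 0 <= k1 `^ p * S * u by rewrite !mulr_ge0// ltW.
  by nra.
apply: (le_trans final).
rewrite (_ : _ * u * sg = 2 * (k1 `^ p + k2 `^ p + 1) * u * (eta^-1 * sg)); last by ring.
apply: ler_wpM2l; last by rewrite ler_pdivlMl.
by rewrite !mulr_ge0 ?addr_ge0 ?ltW.
Qed.

(** On []-1, 0[] the curve has constant velocity [F z0]; this piece only makes derivatives at 0
    two-sided. *)
Definition is_flow (z0 : 'cV[R]_N) (w : R -> 'cV[R]_N) := w 0 = z0 /\
  forall t : R, -1 < t -> is_derive t 1 w (F (w (Num.max t 0))).

(** * Energy along the flow of the unscaled field *)

Section Flow.
Context (z0 : 'cV[R]_N) (w : R -> 'cV[R]_N).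
Hypothesis wP : is_flow z0 w.

Let w_cont (t : R) : 0 <= t -> {for t, continuous w}.
Proof.
move=> t0; apply: is_derive_continuous (wP.2 t _).
by rewrite (lt_le_trans _ t0)// ltrN10.
Qed.

Let E t := V (w t - zs).

Lemma flow_energy_cont (t : R) : 0 <= t -> {for t, continuous (fun s => V (w s - zs))}.
Proof.
move=> t0; apply: continuous_V; apply: cvgB; [exact: w_cont|exact: cvg_cst].
Qed.

Lemma flow_energy_derive (t : R) : 0 <= t ->
  is_derive t 1 (fun s => V (w s - zs)) (2 * dot (w t - zs) (P *m F (w t))).
Proof.
move=> t0; apply: is_derive_V.
have D : is_derive t 1 w (F (w t)).
  by have := wP.2 t; rewrite max_l//; apply; rewrite (lt_le_trans _ t0)// ltrN10.
rewrite (_ : (fun s => _) = w - cst zs)//.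
by apply: is_derive_eq; rewrite subr0.
Qed.

Lemma flow_energy_nincr (s t : R) : 0 <= s <= t -> E t <= E s.
Proof.
move=> /andP[s0 st]; apply: (@derive_le0_nincr _ E
    (fun r => 2 * dot (w r - zs) (P *m F (w r)))) => // r /andP[sr _].
  by apply: flow_energy_cont; apply: le_trans sr.
split; first by apply: flow_energy_derive; rewrite (le_trans s0)// ltW.
apply: (le_trans (decay_up (w r))); rewrite mulNr oppr_le0.
by rewrite mulr_ge0// divr_ge0 ?mulr_ge0// ltW.
Qed.

Lemma flow_energy_le (t : R) : 0 <= t -> E t <= E 0 * expR (- (2 * c / b) * t).
Proof.
move=> t0; set k := 2 * c / b.
have : E t * expR (k * t) <= E 0 * expR (k * 0).
  apply: (@derive_le0_nincr _ (fun t => E t * expR (k * t))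
    (fun t => 2 * dot (w t - zs) (P *m F (w t)) * expR (k * t) + E t * (k * expR (k * t)))) => //.
    move=> s /andP[s0 _]; apply: cvgM; first exact: flow_energy_cont.
    exact: is_derive_continuous (is_derive_expR_linear k s).
  move=> s /andP[/ltW s0 _]; split.
    by apply: is_derive_mulf; [exact: flow_energy_derive|exact: is_derive_expR_linear].
  have := decay_up (w s); rewrite -/k -/(E s) => h.
  by have := ler_wpM2r (expR_ge0 (k * s)) h; lra.
by rewrite mulr0 expR0 mulr1 mulNr expRN ler_pdivlMr ?expR_gt0.
Qed.

(** Backward Gronwall: by [decay_low], [E t * expR (k * t)] is nondecreasing, so a positive energy
    stays positive. Hence [1 / sigma] can be integrated along the whole flow. *)
Lemma flow_neq (t : R) : z0 != zs -> 0 <= t -> w t != zs.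
Proof.
move=> z0zs t0; rewrite -subr_eq0 -V_gt0 -/(E t).
set k := 1 + b * K ^+ 2 / a.
have : - (E t * expR (k * t)) <= - (E 0 * expR (k * 0)).
  apply: (@derive_le0_nincr _ (fun t => - (E t * expR (k * t)))
    (fun t => - (2 * dot (w t - zs) (P *m F (w t)) * expR (k * t) + E t * (k * expR (k * t))))) => //.
    move=> s /andP[s0 _]; apply: cvgN; apply: cvgM; first exact: flow_energy_cont.
    exact: is_derive_continuous (is_derive_expR_linear k s).
  move=> s /andP[/ltW s0 _]; split.
    apply: is_deriveN.
    by apply: is_derive_mulf; [exact: flow_energy_derive|exact: is_derive_expR_linear].
  have := decay_low (w s); rewrite -/k -/(E s) => h.
  by have := ler_wpM2r (expR_ge0 (k * s)) h; lra.
rewrite mulr0 expR0 mulr1 lerN2 => h.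
rewrite -(pmulr_lgt0 _ (expR_gt0 (k * t))); apply: lt_le_trans h.
by rewrite /E wP.1 V_gt0 subr_eq0.
Qed.

Lemma flow_clock : z0 != zs -> exists2 th : R -> R, th 0 = 0 &
  forall t : R, -1 < t -> is_derive t 1 th (sigma (w (Num.max t 0)))^-1.
Proof.
move=> z0zs; apply: primitive_exists => t.
apply: (@continuous_compf _ _ _ (fun s : R => sigma (w (Num.max s 0))) (@GRing.inv R)).
  apply: (@continuous_compf _ _ _ (fun s : R => w (Num.max s 0)) sigma).
    apply: (@continuous_compf _ _ _ (fun s : R => Num.max s 0) w).
      exact: maxr0_continuous.
    by apply: w_cont; rewrite le_max lexx orbT.
  by apply: sigma_cont; apply: flow_neq => //; rewrite le_max lexx orbT.
apply: inv_continuous; rewrite gt_eqF// sigma_gt0//.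
by apply: flow_neq => //; rewrite le_max lexx orbT.
Qed.

End Flow.

Let is_clock (w : R -> 'cV[R]_N) (th : R -> R) := th 0 = 0 /\
  forall t : R, -1 < t -> is_derive t 1 th (sigma (w (Num.max t 0)))^-1.

(** Along the flow [U = E^p] satisfies [U' <= - (2 * c * p / b) * U]. The value of [A] is such that
    [A / (1 + U)] then increases at rate at least [C * U / (1 + U)^2], which dominates the clock
    speed [1 / sigma]. So [th] grows by less than [A / (1 + U)] does, and the latter stays in
    [[0, A]]. *)
Let clock_bound : exists2 A : R, 0 < A & forall z0 w th, z0 != zs ->
  is_flow z0 w -> is_clock w th -> forall t : R, 0 <= t -> th t <= A.
Proof.
have [C C0 CP] := rate_bound.
exists (C * b / (2 * c * p)); first by rewrite divr_gt0// mulr_gt0// mulr_gt0.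
set A := C * b / (2 * c * p) => z0 w th z0zs wP [th0 thP] t t0.
have A0 : 0 < A by rewrite divr_gt0// mulr_gt0// mulr_gt0.
pose E s := V (w s - zs); pose U s := E s `^ p.
pose dE s := 2 * dot (w s - zs) (P *m F (w s)).
pose dU s := p * E s `^ (p - 1) * dE s.
have E_gt0 (s : R) : 0 <= s -> 0 < E s.
  by move=> s0; rewrite V_gt0 subr_eq0; apply: flow_neq wP _ _ _.
have U_gt0 (s : R) : 0 <= s -> 0 < U s by move=> /E_gt0; exact: powR_gt0.
have HU (s : R) : 0 <= s -> is_derive s 1 U (dU s).
  move=> s0; apply: (@is_derive1_comp _ (fun x => x `^ p)).
    exact: is_derive1_powR (E_gt0 s s0).
  exact: flow_energy_derive wP _ _.
have HI (s : R) : 0 <= s -> is_derive s 1 (fun r => (1 + U r)^-1) (- (1 + U s) ^- 2 *: dU s).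
  move=> s0; apply: is_deriveV; first by rewrite gt_eqF// addr_gt0// U_gt0.
  have D := HU s s0; rewrite (_ : (fun r => _) = cst 1 + U)//.
  by apply: is_derive_eq; rewrite add0r.
have Hth (s : R) : 0 <= s -> is_derive s 1 th (sigma (w s))^-1.
  by move=> s0; have := thP s; rewrite max_l//; apply; rewrite (lt_le_trans _ s0)// ltrN10.
have Hf (s : R) : 0 <= s -> is_derive s 1 (fun r => th r - A * (1 + U r)^-1)
    ((sigma (w s))^-1 - A * (- (1 + U s) ^- 2 *: dU s)).
  move=> s0; have D1 := Hth s s0; have D2 := HI s s0.
  have D3 := is_derive_mull A _ _ _ D2.
  exact: is_deriveB.
have : th t - A * (1 + U t)^-1 <= th 0 - A * (1 + U 0)^-1.
  apply: (@derive_le0_nincr _ (fun r => th r - A * (1 + U r)^-1)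
     (fun s => (sigma (w s))^-1 - A * (- (1 + U s) ^- 2 *: dU s))) => // s /andP[s0 _].
    exact: is_derive_continuous (Hf s s0).
  split; first by apply: Hf; exact: ltW.
  have ws : w s != zs by apply: flow_neq wP _ _ _ => //; exact: ltW.
  have sg := sigma_gt0 (w s) ws.
  have h1 := CP (w s) ws; rewrite -/(E s) -/(U s) in h1.
  have u0 := U_gt0 s (ltW s0).
  have h2 : dU s <= - (2 * c * p / b) * U s.
    have := decay_up (w s); rewrite -/(dE s) -/(E s) => h.
    have := ler_wpM2l (mulr_ge0 (ltW p_gt0) (powR_ge0 (E s) (p - 1))) h.
    rewrite -/(dU s) => /le_trans; apply.
    rewrite le_eqVlt; apply/orP; left; apply/eqP.
    by rewrite /U -(mulr_powRB1 _ p_gt0) ?ltW ?E_gt0 ?(ltW s0)//; ring.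
  have q0 : 0 < (1 + U s) ^+ 2 by rewrite exprn_gt0// addr_gt0.
  have h3 : (sigma (w s))^-1 <= C * U s / (1 + U s) ^+ 2.
    by rewrite ler_pdivlMr// mulrC ler_pdivrMr.
  have h4 : A / (1 + U s) ^+ 2 * dU s <= - (C * U s / (1 + U s) ^+ 2).
    have := ler_wpM2l (ltW (divr_gt0 A0 q0)) h2 => /le_trans; apply.
    rewrite le_eqVlt; apply/orP; left; apply/eqP; rewrite /A; field.
    by rewrite !gt_eqF// addr_gt0.
  have -> : A * (- (1 + U s) ^- 2 *: dU s) = - (A / (1 + U s) ^+ 2 * dU s).
    by rewrite /GRing.scale/=; ring.
  by lra.
rewrite th0 => h.
have i0 : 0 <= (1 + U 0)^-1 by rewrite invr_ge0 addr_ge0// ltW// U_gt0.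
have i1 : (1 + U t)^-1 <= 1 by rewrite invf_le1 ?addr_gt0 ?U_gt0// lerDl ltW// U_gt0.
apply: (@le_trans _ _ (A * (1 + U t)^-1)); last by rewrite ler_piMr// ltW.
by rewrite -subr_le0 (le_trans h)// sub0r oppr_le0 mulr_ge0// ltW.
Qed.

(** For [|F z| <= 1] the norm of [G z] is at most [(eta1 + eta2) * |F z|^(1 - lambda1)], and
    [lambda1 < 1] makes this small near [zs]. *)
Let G_small (e : R) : 0 < e -> exists2 d : R, 0 < d &
  forall z, enorm (z - zs) < d -> enorm (G z) <= e.
Proof.
move=> e0; have [l0 l1] := andP lambda1_01.
set r := 1 - lambda1; have r0 : 0 < r by rewrite subr_gt0.
have eta0 : 0 < eta1 + eta2 by rewrite addr_gt0.
pose q := e / (eta1 + eta2); have q0 : 0 < q by rewrite divr_gt0.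
(* The second entry solves [(eta1 + eta2) * x^r = e]; the cap 1 lets the power [r] dominate the
   power [1 + lambda2]. *)
pose x0 := Num.min 1 (q `^ r^-1).
have x00 : 0 < x0 by rewrite lt_min ltr01 powR_gt0.
exists (x0 / K) => [|z]; first by rewrite divr_gt0.
rewrite ltr_pdivlMr// mulrC => hz.
have xx : enorm (F z) < x0 by apply: le_lt_trans hz; exact: lip0.
have [Fz|Fz] := eqVneq (F z) 0.
  by rewrite /G Fz scaler0 [enorm 0](_ : _ = 0) ?ltW//; apply/eqP; rewrite enorm_eq0.
have xp : 0 < enorm (F z) by rewrite enorm_gt0.
rewrite /G enormZ ger0_norm// sigmaE -?F_eq0//.
set x := enorm (F z) in xx xp *.
have [x1 xq] : x < 1 /\ x < q `^ r^-1 by move: xx; rewrite lt_min => /andP.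
have x01 : 0 < x <= 1 by rewrite xp ltW.
have y1 : x `^ (- lambda1) * x = x `^ r.
  by rewrite -{2}(powRr1 (ltW xp)) -powRD ?(gt_eqF xp) ?implybT// addrC.
have y2 : x `^ lambda2 * x <= x `^ r.
  rewrite -y1 ler_wpM2r ?(ltW xp)// ger_powR//.
  by rewrite (le_trans (y := 0)) ?oppr_le0 ?ltW.
have y3 : x `^ r <= q.
  rewrite -[leRHS](powRr1 (ltW q0)) -(mulVf (lt0r_neq0 r0)) powRrM.
  by rewrite ge0_ler_powR ?nnegrE ?ltW ?powR_gt0.
rewrite mulrDl -!mulrA y1.
apply: (@le_trans _ _ ((eta1 + eta2) * x `^ r)).
  by rewrite mulrDl lerD2l ler_wpM2l// ltW.
by rewrite -ler_pdivlMl// mulrC.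
Qed.


Let G_zs : G zs = 0.
Proof. by rewrite /G Fzs scaler0. Qed.

(** * Arbitrary solutions of the rescaled system *)

Section Solution.
Context (z0 : 'cV[R]_N) (z : R -> 'cV[R]_N).
Hypothesis zP : is_solution G z0 z.

Let zz (t : R) := z (Num.max t 0).

Let zz_cont : continuous zz.
Proof. by case: zP => _ + _; exact: continuous_max0. Qed.

Let zzE (t : R) : 0 <= t -> zz t = z t.
Proof. by move=> t0; rewrite /zz max_l. Qed.

Let zz_derive (t : R) : 0 < t -> is_derive t 1 zz (G (z t)).
Proof.
move=> t0; case: zP => _ _ /(_ t t0); apply: near_eq_is_derive.
near=> s; rewrite zzE//; apply: ltW; near: s; exact: lt_nbhsr.
Unshelve. all: by end_near. Qed.

Lemma solution_energy_nincr (s t : R) : 0 <= s <= t -> V (z t - zs) <= V (z s - zs).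
Proof.
move=> /andP[s0 st]; rewrite -!zzE ?(le_trans s0)//.
apply: (@derive_le0_nincr _ (fun r => V (zz r - zs))
    (fun r => 2 * dot (zz r - zs) (P *m G (z r)))) => // r /andP[sr _].
  apply: continuous_V; apply: (@cvgB _ _ _ (nbhs r) _ zz (fun=> zs)).
    exact: zz_cont.
  exact: cvg_cst.
have r0 : 0 < r by exact: le_lt_trans sr.
split.
  apply: is_derive_V; have D := zz_derive r r0.
  rewrite (_ : (fun _ => _) = zz - cst zs)//.
  by apply: is_derive_eq; rewrite subr0.
rewrite zzE ?(ltW r0)// /G -scalemxAr dotZr mulrCA.
rewrite mulr_ge0_le0 ?sigma_ge0//; apply: (le_trans (decay_up (z r))).
by rewrite mulNr oppr_le0 mulr_ge0// divr_ge0 ?mulr_ge0// ltW.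
Qed.

(* With [S' = sigma (z)], the curves [w \o S] and [z] solve the same
   non-autonomous equation [x' = sigma (z t) F x], whose right-hand side is
   monotone; hence they agree. *)
Lemma solution_eq_flow (w : R -> 'cV[R]_N) (th : R -> R) (t1 : R) :
  z0 != zs -> is_flow z0 w -> is_clock w th -> 0 <= t1 ->
  (forall t : R, 0 <= t <= t1 -> z t != zs) ->
  exists S, [/\ 0 <= S, th S = t1 & z t1 = w S].
Proof.
move=> z0zs wP [th0 thP] t10 zzs.
(* [z] is known to avoid [zs] on [[0, t1]] only; clamping time to that interval makes the integrand
   [sigma (z t)] continuous on the whole line. *)
pose cl (t : R) := Num.min (Num.max t 0) t1.
have cl01 t : 0 <= cl t <= t1.
  by rewrite /cl le_min t10 le_max lexx orbT/= ge_min lexx orbT.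
have clE t : 0 <= t <= t1 -> cl t = t.
  by move=> /andP[t0 tt1]; rewrite /cl max_l// min_l.
have cl_cont : continuous cl.
  move=> t; apply: (@continuous_min _ _ (fun s : R => Num.max s 0) (fun=> t1)).
    exact: maxr0_continuous.
  exact: cvg_cst.
have [|S S0 SP] := primitive_exists (fun t => sigma (zz (cl t))).
  move=> t; apply: (@continuous_compf _ _ _ (fun t => zz (cl t)) sigma).
    by apply: (@continuous_compf _ _ _ cl zz); [exact: cl_cont|exact: zz_cont].
  apply: sigma_cont; have h := cl01 t; rewrite zzE; first exact: zzs.
  by case/andP: h.
have lt1 (t : R) : 0 <= t -> -1 < t by move=> t0; rewrite (lt_le_trans _ t0)// ltrN10.
have Sc (t : R) : 0 <= t -> {for t, continuous S}.
  by move=> t0; apply: is_derive_continuous (SP t _); exact: lt1.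
have S_ge0 (t : R) : 0 <= t -> 0 <= S t.
  move=> t0; rewrite -oppr_le0 -oppr0 -S0.
  apply: (@derive_le0_nincr _ (fun t => - S t) (fun t => - sigma (zz (cl t)))) => // s /andP[s0 _].
    by apply: cvgN; exact: Sc.
  split; last by rewrite oppr_le0.
  by apply: is_deriveN; apply: SP; apply: lt1; exact: ltW.
have wS_derive (t : R) : 0 <= t <= t1 ->
    is_derive t 1 (fun r => w (S r)) (sigma (z t) *: F (w (S t))).
  move=> t01; have /andP[t0 _] := t01.
  have D1 := SP t (lt1 t t0); rewrite clE// zzE// in D1.
  apply: is_derive_comp_curve D1.
  by have := wP.2 (S t); rewrite max_l ?S_ge0//; apply; apply: lt1; exact: S_ge0.
pose D t := V (w (S t) - zz t).
have wSE (t : R) : 0 <= t <= t1 -> w (S t) = z t.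
  move=> t01; have /andP[t0 tt1] := t01.
  have : D t <= D 0.
    apply: (@derive_le0_nincr _ D (fun r =>
        2 * dot (w (S r) - zz r) (P *m (sigma (z r) *: F (w (S r)) - G (z r))))) => //.
      move=> s /andP[s0 st]; apply: continuous_V.
      apply: (@cvgB _ _ _ (nbhs s) _ (fun r => w (S r)) zz); last exact: zz_cont.
      by apply: is_derive_continuous (wS_derive s _); rewrite s0 (le_trans st).
    move=> s /andP[s0 st].
    have s01 : 0 <= s <= t1 by rewrite ltW//= ltW// (lt_le_trans st).
    split.
      apply: is_derive_V; have D1 := wS_derive s s01; have D2 := zz_derive s s0.
      exact: (@is_deriveB _ _ _ (fun r => w (S r)) zz).
    rewrite zzE ?(ltW s0)// /G -scalerBr -scalemxAr dotZr mulrCA.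
    rewrite mulr_ge0_le0// mulr_ge0_le0//; apply: (le_trans (F_mono _ _)).
    by rewrite mulNr oppr_le0 mulr_ge0 ?dot_ge0// ltW.
  have -> : D 0 = 0.
    rewrite /D S0 wP.1 zzE//; case: zP => -> _ _.
    by rewrite subrr /V dot0l.
  move=> h; apply/eqP; rewrite -subr_eq0 -V_eq0 eq_le V_ge0 andbT.
  by move: h; rewrite /D zzE.
exists (S t1); split; first exact: S_ge0.
  (* [S] and the clock have reciprocal speeds, so [th (S t) - t] is constant. *)
  have : th (S t1) - t1 = th (S 0) - 0.
    apply: (@derive0_cst _ (fun t => th (S t) - t)) => // t.
      move=> /andP[t0 _]; apply: (@cvgB _ _ _ (nbhs t) _ (fun r => th (S r)) id).
        apply: (@continuous_compf _ _ _ S th); first exact: Sc.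
        by apply: is_derive_continuous (thP (S t) _); apply: lt1; exact: S_ge0.
      exact: cvg_id.
    move=> /andP[t0 tt1]; have t01 : 0 <= t <= t1 by rewrite !ltW.
    have D1 := SP t (lt1 t (ltW t0)); rewrite clE// zzE ?(ltW t0)// in D1.
    have D2 := thP (S t) (lt1 _ (S_ge0 t (ltW t0))).
    rewrite max_l ?S_ge0 ?(ltW t0)// wSE// in D2.
    have D3 := @is_derive1_comp R th S t _ _ D2 D1.
    rewrite mulVf ?gt_eqF ?sigma_gt0 ?zzs// in D3.
    rewrite (_ : (fun _ => _) = (th \o S) - id)//.
    by apply: is_derive_eq; rewrite subrr.
  by rewrite S0 th0 subrr => /eqP; rewrite subr_eq0 => /eqP.
by rewrite wSE// t10 lexx.
Qed.

(** As long as it avoids [zs], a solution is the flow read through the clock, whose energy is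
    bounded below before [tau]; so it cannot arrive early. If it still avoided [zs] at [tau], the
    clock would attain [tau], which it only approaches. *)
Lemma solution_settles (w : R -> 'cV[R]_N) (th : R -> R) (tau : R) (s : R -> R) :
  z0 != zs -> is_flow z0 w -> is_clock w th -> 0 < tau ->
  (forall r : R, 0 <= r -> th r < tau) ->
  (forall t : R, 0 <= t < tau -> 0 <= s t /\ th (s t) = t) ->
  (forall r t : R, 0 <= r -> th r <= t < tau -> r <= s t) ->
  [/\ z t @[t --> within `[0, +oo[%classic (nbhs tau)] --> zs,
      z tau = zs & forall t : R, 0 <= t < tau -> z t <> zs].
Proof.
move=> z0zs wP thP tau0 th_tau sP s_ge.
have before (t0 : R) : 0 <= t0 < tau -> z t0 != zs.
  move=> t0tau; have /andP[t00 tt] := t0tau.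
  apply/negP => /eqP zt0.
  have [s0 _] := sP t0 t0tau.
  pose v0 := V (w (s t0) - zs).
  have v00 : 0 < v0 by rewrite V_gt0 subr_eq0; apply: flow_neq wP _ _ _.
  have low S : 0 <= S -> th S <= t0 -> v0 <= V (w S - zs).
    move=> S0 Sle; apply: flow_energy_nincr wP _ _ _; rewrite S0/=.
    by apply: s_ge => //; rewrite Sle.
  have zzV_cont (t : R) : {for t, continuous (fun r => V (zz r - zs))}.
    apply: continuous_V; apply: (@cvgB _ _ _ (nbhs t) _ zz (fun=> zs)).
      exact: zz_cont.
    exact: cvg_cst.
  (* At [t'] the energy of [z] is [v0 / 2]. It is positive up to there, so [z t'] is a flow point
     with clock time at most [t0], whose energy should be at least [v0]. *)
  have [||t' t'in ft'] := @IVT R (fun t => V (zz t - zs)) 0 t0 (v0 / 2) t00.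
  - apply: continuous_subspaceT => t; exact: zzV_cont.
  - have -> : V (zz t0 - zs) = 0 by rewrite zzE// zt0 subrr /V dot0l.
    have : v0 <= V (zz 0 - zs).
      rewrite zzE//; case: zP => -> _ _; rewrite -wP.1; apply: low => //.
      by rewrite thP.1.
    move=> h; rewrite ge_min le_max divr_ge0 ?(ltW v00)// orbT/= (le_trans _ h)//.
    by rewrite ler_pdivrMr// ler_peMr ?(ltW v00)// ler1n.
  move: t'in; rewrite in_itv/= => /andP[t'0 t't0].
  have nz (t : R) : 0 <= t <= t' -> z t != zs.
    move=> tt'; have := solution_energy_nincr t t' tt'.
    rewrite -(zzE t')// ft' => h.
    by rewrite -subr_eq0 -V_gt0; apply: lt_le_trans h; rewrite divr_gt0.
  have [S [S0 SE zS]] := solution_eq_flow w th t' z0zs wP thP t'0 nz.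
  have := low S S0; rewrite SE => /(_ t't0).
  by rewrite -zS -zzE// ft'; lra.
have at_tau : z tau = zs.
  apply/eqP/contraT => ztau.
  have nz (t : R) : 0 <= t <= tau -> z t != zs.
    move=> /andP[t0]; rewrite le_eqVlt => /predU1P[->//|tt].
    by apply: before; rewrite t0.
  have [S [S0 SE _]] := solution_eq_flow w th tau z0zs wP thP (ltW tau0) nz.
  by have := th_tau S S0; rewrite SE ltxx.
split => //; last by move=> t tt; apply/eqP; exact: before.
rewrite -at_tau; case: zP => _ /subspace_continuousP + _; apply.
by rewrite /= in_itv/= andbT ltW.
Qed.

End Solution.

(** * Stability, existence of solutions and settling time *)

Lemma rescaled_lyapunov_stable : lyapunov_stable G zs.
Proof.
move=> e e0; have ab : 0 < a / b by rewrite divr_gt0.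
(* From [a * |z t - zs|^2 <= V (z t - zs) <= V (z0 - zs) <= b * |z0 - zs|^2]. *)
exists (Num.sqrt (a / b) * e); first by rewrite mulr_gt0// sqrtr_gt0.
move=> z0 z; rewrite enorm_lt_sqr ?mulr_gt0 ?sqrtr_gt0// => hz0 zP t t0.
rewrite enorm_lt_sqr//.
rewrite exprMn sqr_sqrtr ?(ltW ab)// in hz0.
have h : V (z t - zs) <= V (z0 - zs).
  have := solution_energy_nincr z0 z zP 0 t; rewrite lexx/= => /(_ t0).
  by case: zP => ->.
rewrite -(ltr_pM2l a_gt0); apply: (le_lt_trans (P_ge _)); apply: (le_lt_trans h).
apply: (le_lt_trans (P_le _)).
have := hz0; rewrite -(ltr_pM2l b_gt0) => /lt_le_trans; apply.
by rewrite le_eqVlt; apply/orP; left; apply/eqP; field; rewrite gt_eqF.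
Qed.

(** The flow is read through the inverse clock [s] before [tau] and continued by the constant [zs].
    The delicate point is differentiability at [tau], with derivative [G zs = 0]. *)
Lemma rescaled_solution_exists (z0 : 'cV[R]_N) (w : R -> 'cV[R]_N) (th : R -> R)
    (tau : R) (s : R -> R) :
  z0 != zs -> is_flow z0 w -> 0 < tau -> th 0 = 0 ->
  (forall r : R, 0 <= r -> th r < tau) ->
  (forall t : R, 0 <= t < tau -> 0 <= s t /\ th (s t) = t) ->
  (forall r t : R, 0 <= r -> th r <= t < tau -> r <= s t) ->
  (forall t : R, 0 <= t < tau -> is_derive t 1 s (sigma (w (s t)))) ->
  s 0 = 0 ->
  exists z, is_solution G z0 z.
Proof.
move=> z0zs wP tau0 th0 th_tau sP s_ge s_derive s0.
pose z (t : R) := if t < tau then w (s t) else zs.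
have z_before (t : R) : 0 <= t < tau -> is_derive t 1 z (G (z t)).
  move=> tt; have /andP[t0 ttau] := tt.
  apply: (@near_eq_is_derive _ _ _ (fun r => w (s r))).
    near=> r; rewrite /z; have -> // : r < tau.
    by near: r; exact: lt_nbhsl.
  rewrite {1}/z ttau; apply: is_derive_comp_curve (s_derive t tt).
  have [st0 _] := sP t tt.
  have := wP.2 (s t); rewrite max_l//; apply.
  by rewrite (lt_le_trans _ st0)// ltrN10.
have z_tau : z tau = zs by rewrite /z ltxx.
have close (e : R) : 0 < e -> exists2 d : R, 0 < d < tau &
    forall t : R, tau - d < t -> enorm (z t - zs) < e.
  move=> e0; set E0 := V (w 0 - zs).
  have E00 : 0 <= E0 by exact: V_ge0.
  pose k := 2 * c / b; have k0 : 0 < k by rewrite divr_gt0// mulr_gt0.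
  pose m := a * e ^+ 2; have m0 : 0 < m by rewrite mulr_gt0// exprn_gt0.
  (* By [expR x >= 1 + x], the exponential bound on the energy is below [m = a * e ^+ 2] from flow
     time [r0] on. *)
  pose r0 := E0 / m / k.
  have r00 : 0 <= r0 by exact: divr_ge0 (divr_ge0 E00 (ltW m0)) (ltW k0).
  have small : E0 * expR (- k * r0) < m.
    rewrite mulNr expRN ltr_pdivrMr ?expR_gt0//.
    have := expR_ge1Dx (k * r0); rewrite {1}/r0 mulrC divfK ?gt_eqF// => h.
    have := ler_wpM2l (ltW m0) h; rewrite mulrDr mulr1 mulrCA divff ?gt_eqF// mulr1.
    by apply: lt_le_trans; rewrite ltrDr.
  have d0 : 0 < tau - th r0 by rewrite subr_gt0 th_tau.
  (* The second entry keeps [tau - d] positive. *)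
  exists (Num.min (tau - th r0) (tau / 2)).
    rewrite lt_min d0 divr_gt0//= gt_min orbC.
    by rewrite ltr_pdivrMr// ltr_pMr// ltr1n.
  move=> t; rewrite ltrBlDr -ltrBlDl lt_min => /andP[ht1 ht2].
  have [ttau|ttau] := ltP t tau; last first.
    by rewrite /z [t < tau]ltNge ttau/= subrr [enorm 0](_ : _ = 0)//; apply/eqP; rewrite enorm_eq0.
  rewrite enorm_lt_sqr// /z ttau -(ltr_pM2l a_gt0) -/m.
  apply: (le_lt_trans (P_ge _)); apply: le_lt_trans small.
  have rs : r0 <= s t by apply: s_ge => //; rewrite ttau andbT; lra.
  apply: le_trans (flow_energy_le z0 w wP r0 r00).
  by apply: flow_energy_nincr wP _ _ _; rewrite r00.
have z_tau_cont : {for tau, continuous z}.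
  apply/(@cvg_enormP _ _ (nbhs tau)) => e e0; rewrite z_tau.
  have [d /andP[d0 _] dP] := close e e0.
  near=> t; apply: dP; near: t; apply: lt_nbhsr.
  by rewrite ltrBlDr ltrDl.
(* Just before [tau] the velocity [G (z t)] is small since [z t] is close to [zs]; the mean value
   inequality on [[t, tau]] turns this into a bound [e * (tau - t)]. *)
have z_tau_derive : is_derive tau 1 z 0.
  apply/is_derive_coordP => i; rewrite mxE; apply: is_derive0_squeeze => e e0.
  have [d' d'0 d'P] := G_small e e0.
  have [d /andP[d0 dtau] dP] := close d' d'0.
  near=> t.
  have td : tau - d < t by near: t; apply: lt_nbhsr; rewrite ltrBlDr ltrDl.
  have [ttau|ttau] := leP tau t.
    rewrite (_ : z t = z tau) ?subrr ?normr0 ?mulr_ge0 ?(ltW e0)//.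
    by rewrite /z ltxx ltNge ttau.
  rewrite distrC (distrC t) (ger0_norm (_ : 0 <= tau - t)); last by rewrite subr_ge0 ltW.
  have := @derive_bound R (fun r => z r i 0) (fun r => G (z r) i 0)
    (fun r => e * r) (fun=> e) t tau (ltW ttau); rewrite -mulrBr; apply.
    move=> r /andP[tr rtau]; split; last by apply: cvgM; [exact: cvg_cst|exact: cvg_id].
    have zr : {for r, continuous z}.
      move: rtau; rewrite le_eqVlt => /predU1P[->//|rtau].
      apply: is_derive_continuous (z_before r _); rewrite rtau andbT.
      by apply: le_trans tr; lra.
    by have /(@cvg_coordP _ _ (nbhs r)) := zr; exact.
  move=> r /andP[tr rtau]; split.
  - have rt : 0 <= r < tau by rewrite rtau andbT; lra.
    by have /is_derive_coordP := z_before r rt; exact.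
  - have := is_derive_mull e _ _ _ (is_derive_id r 1); rewrite mulr1; exact.
  - by apply: (le_trans (coord_le_enorm _ _)); apply: d'P; apply: dP; lra.
have z_after (t : R) : tau < t -> is_derive t 1 z 0.
  move=> ttau; have D : is_derive t 1 (fun=> zs) 0 := is_derive_cst zs t 1.
  apply: near_eq_is_derive D.
  near=> r; rewrite /z ltNge (_ : tau <= r)//; apply: ltW; near: r; exact: lt_nbhsr.
have z_derive (t : R) : 0 <= t -> is_derive t 1 z (G (z t)).
  move=> t0; have [ttau|ttau|->] := ltgtP t tau.
  - by apply: z_before; rewrite t0.
  - by rewrite {2}/z ltNge (ltW ttau)/= G_zs; exact: z_after.
  - by rewrite z_tau G_zs.
exists z; split.
- by rewrite /z tau0 s0 wP.1.
- apply: continuous_in_subspaceT => t; rewrite inE/= in_itv/= andbT => t0.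
  exact: is_derive_continuous (z_derive t t0).
- by move=> t /ltW; exact: z_derive.
Unshelve. all: by end_near. Qed.

Theorem strongly_monotone_fixed_time_stable : globally_fixed_time_stable G zs.
Proof.
(* [A] is fixed before the starting point, which is what makes the settling time uniformly
   bounded. *)
have [A A0 AP] := clock_bound.
have H z0 : exists tau : R, [/\ 0 <= tau <= A, exists z, is_solution G z0 z &
    forall z, is_solution G z0 z ->
      [/\ z t @[t --> within `[0, +oo[%classic (nbhs tau)] --> zs,
          z tau = zs & forall t : R, 0 <= t < tau -> z t <> zs]].
  have [->|z0zs] := eqVneq z0 zs.
    exists 0; split; first by rewrite lexx ltW.
      exists (fun=> zs); split => // [|t t0].
        by apply: continuous_subspaceT => t; exact: cvg_cst.
      by rewrite G_zs; exact: is_derive_cst.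
    move=> z zP; have z00 : z 0 = zs by case: zP.
    split => //; last by move=> t /andP[t0 /(le_lt_trans t0)]; rewrite ltxx.
    rewrite -[X in _ --> X]z00; case: zP => _ /subspace_continuousP + _; apply.
    by rewrite /= in_itv/= lexx.
  have [w w0 wD] := flow_exists F K F_lip z0.
  have wP : is_flow z0 w by split.
  have [th th0 thD] := flow_clock z0 w wP z0zs.
  have thP : is_clock w th by split.
  have sg (t : R) : -1 < t -> 0 < (sigma (w (Num.max t 0)))^-1.
    move=> _; rewrite invr_gt0 sigma_gt0//; apply: flow_neq wP _ _ _ => //.
    by rewrite le_max lexx orbT.
  have [tau [s [/andP[tau0 tauA] h1 h2 [h3 h4]]]] := bounded_clock_inverse th
    (fun t => (sigma (w (Num.max t 0)))^-1) A th0 thD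
    sg (AP z0 w th z0zs wP thP).
  exists tau; split; first by rewrite ltW.
    have tau00 : 0 <= (0 : R) < tau by rewrite lexx.
    apply: (@rescaled_solution_exists z0 w th tau s) => //.
      move=> t tt; have := h4 t tt; have [s0 _] := h2 t tt.
      by rewrite max_l// invrK.
    have [s0 ths0] := h2 0 tau00; apply/eqP; rewrite eq_le s0 andbT.
    rewrite leNgt; apply/negP => s00.
    have := @derive_gt0_incr R th (fun t => (sigma (w (Num.max t 0)))^-1) 0 (s 0) s00.
    rewrite th0 ths0 ltxx => h.
    suff : false by []; apply: h => t /andP[t0 _].
      by apply: is_derive_continuous (thD t _); rewrite (lt_le_trans _ t0)// ltrN10.
    split; first by apply: thD; rewrite (lt_trans _ t0)// ltrN10.
    rewrite invr_gt0 sigma_gt0//; apply: flow_neq wP _ _ _ => //.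
    by rewrite le_max lexx orbT.
  by move=> z zP; apply: (@solution_settles z0 z zP w th tau s).
have /choice[tau tauP] := H.
have tau_set : is_settling_time G zs tau.
  by move=> z0; have [/andP[? _] _ ?] := tauP z0; split.
split; last first.
  exists tau => //; exists A => _ [z0 _ <-].
  by have [/andP[]] := tauP z0.
split; [exact: G_zs| |exact: rescaled_lyapunov_stable|by exists tau].
by move=> z0; have [] := tauP z0.
Qed.

End StronglyMonotone.

(** * Convexity and the Moreau envelope *)

Section Convex.
Context {R : realType} {n : nat}.

Lemma convex_functionP (h : 'cV[R]_n -> R) : convex_function setT h ->
  forall x y t, 0 <= t <= 1 -> h (t *: x + (1 - t) *: y) <= t * h x + (1 - t) * h y.
Proof.
move=> hc x y t /andP[t0 t1].
by have := hc (Itv01 t0 t1) x y (in_setT _) (in_setT _).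
Qed.

Lemma nbhs_enorm (x : 'cV[R]_n) (U : set 'cV[R]_n) : nbhs x U ->
  exists2 d : R, 0 < d & forall y, enorm (y - x) < d -> U y.
Proof.
move=> /nbhs_ballP[d d0 dU]; exists d => // y yx; apply: dU.
rewrite -ball_normE /ball_/= /Num.Def.normr/= mx_normrE.
apply: bigmax_lt => // -[i j] _; rewrite (ord1 j) /=.
apply: le_lt_trans yx; rewrite enorm_distC.
exact: coord_le_enorm.
Qed.

(** Performs the limit [t -> 0] in variational inequalities, where division by [t] leaves an affine
    function of [t]. *)
Lemma ge0_right_limit (X Y : R) : (forall t, 0 < t <= 1 -> 0 <= X + t * Y) -> 0 <= X.
Proof.
move=> H; rewrite leNgt; apply/negP => X0.
pose t := Num.min 1 (- X / (2 * (`|Y| + 1))).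
have q0 : 0 < 2 * (`|Y| + 1) by rewrite mulr_gt0// ltr_wpDl.
have t0 : 0 < t by rewrite lt_min ltr01 divr_gt0 ?oppr_gt0.
have t1 : t <= 1 by rewrite ge_min lexx.
have tq : t * (2 * (`|Y| + 1)) <= - X by rewrite -ler_pdivlMr// ge_min lexx orbT.
have /H : 0 < t <= 1 by rewrite t0.
have := ler_wpM2l (ltW t0) (ler_norm Y).
have := normr_ge0 Y; nra.
Qed.

(** A global quadratic remainder follows from a lower and an upper bound without any limit, and
    suffices both to compute [grad] and for Fermat's rule. *)
Definition quadratic_expansion (phi : 'cV[R]_n -> R) (x G : 'cV[R]_n) : Prop :=
  exists C : R, forall h, `|phi (x + h) - phi x - dot G h| <= C * dot h h.

Lemma quadratic_expansion_grad (phi : 'cV[R]_n -> R) x G :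
  quadratic_expansion phi x G -> grad phi x = G.
Proof.
move=> [C CP]; apply/matrixP => i j; rewrite (ord1 j) mxE.
set v := delta_mx i 0.
have Gv : dot G v = G i 0.
  rewrite /dot (bigD1 i)//= mxE !eqxx mulr1 big1 ?addr0// => k ki.
  by rewrite mxE (negbTE ki) mulr0.
rewrite -Gv; apply: cvg_lim => //; apply/cvgrPdist_le => e e0.
pose B := `|C| * dot v v + 1.
have B0 : 0 < B by rewrite ltr_wpDl// mulr_ge0// dot_ge0.
near=> h.
have h0 : h != 0 by near: h; exact: nbhs_dnbhs_neq.
have := CP (h *: v); rewrite (addrC x) !dotZl !dotZr => H.
rewrite distrC -(@ler_pM2l _ `|h|) ?normr_gt0// -normrM.
rewrite mulrBr /GRing.scale/= mulrA divff// mul1r.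
apply: (le_trans H).
have hB : `|h| * B <= e.
  rewrite -ler_pdivlMr//; apply: ltW; near: h.
  by apply: dnbhs0_lt; rewrite divr_gt0.
apply: le_trans (ler_wpM2l (normr_ge0 h) hB).
have -> : C * (h * (h * dot v v)) = h ^+ 2 * (C * dot v v) by ring.
rewrite [leRHS]mulrA -expr2 real_normK ?num_real//.
apply: ler_wpM2l; first exact: sqr_ge0.
rewrite /B; apply: (@le_trans _ _ (`|C| * dot v v)); last by rewrite lerDl.
by rewrite ler_wpM2r ?dot_ge0// ler_norm.
Unshelve. all: by end_near. Qed.

Lemma quadratic_expansion_min (phi : 'cV[R]_n -> R) x G :
  quadratic_expansion phi x G -> (forall y, phi x <= phi y) -> G = 0.
Proof.
move=> [C CP] phi_min; apply/eqP; rewrite -dot_eq0 eq_le dot_ge0 andbT -oppr_ge0.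
apply: (@ge0_right_limit _ (C * dot G G)) => t /andP[t0 _].
have := CP (- t *: G); rewrite !dotZl !dotZr => /(le_trans (ler_norm _)) h.
have := phi_min (x + - t *: G) => h'.
have {}h : t * dot G G <= t ^+ 2 * (C * dot G G).
  have -> : t ^+ 2 * (C * dot G G) = C * (- t * (- t * dot G G)) by ring.
  by lra.
rewrite expr2 -mulrA ler_pM2l// in h; lra.
Qed.

Lemma quadratic_expansionN (phi : 'cV[R]_n -> R) x G :
  quadratic_expansion phi x G -> quadratic_expansion (fun y => - phi y) x (- G).
Proof.
move=> [C CP]; exists C => h; have := CP h; rewrite -normrN dotNl.
by rewrite [X in `|X|](_ : _ = - phi (x + h) - - phi x - - dot G h)//; ring.
Qed.

End Convex.

(** * Proximal points and the gradient of the envelope *)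

Section Prox.
Context {R : realType} {d : nat} (g : 'cV[R]_d -> R) (mu : R).
Hypothesis g_lsc : lower_semicontinuous (fun w => (g w)%:E).
Hypothesis g_cvx : convex_function setT g.
Hypothesis mu_gt0 : 0 < mu.

Let g_cvxP := convex_functionP _ g_cvx.

Let g_lscP x e : 0 < e -> exists2 del : R, 0 < del &
  forall y, enorm (y - x) < del -> g x - e < g y.
Proof.
move=> e0; have [|U /nbhs_enorm[del del0 dU] UP] := g_lsc x (g x - e).
  by rewrite lte_fin ltrBlDr ltrDl.
by exists del => // y /dU/UP; rewrite lte_fin.
Qed.

(** Lower semicontinuity gives [g >= g 0 - 1] on a ball around 0, and convexity on the segment from
    0 to a far [w] carries this outward with at most linear loss. This makes the proximal objective
    bounded below. *)
Lemma convex_lsc_lower_bound : exists A B : R, 0 <= B /\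
  forall w, A - B * enorm w <= g w.
Proof.
have [del' del'0 dP'] := g_lscP 0 1 ltr01.
(* Halved because the rescaled point has norm exactly [del], while semicontinuity speaks of an open
   ball. *)
pose del := del' / 2.
have del0 : 0 < del by rewrite divr_gt0.
have dP w : enorm w <= del -> g 0 - 1 <= g w.
  move=> wd; apply/ltW/dP'; rewrite subr0; apply: (le_lt_trans wd).
  by rewrite /del ltr_pdivrMr// ltr_pMr// ltr1n.
exists (g 0 - 1), del^-1; split; first by rewrite invr_ge0 ltW.
move=> w; have [wd|wd] := leP (enorm w) del.
  apply: le_trans (dP w wd); rewrite gerBl mulr_ge0 ?enorm_ge0// invr_ge0 ltW//.
have w0 : 0 < enorm w by exact: lt_trans wd.
pose s := del / enorm w.
have s0 : 0 < s by rewrite divr_gt0.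
have s1 : s <= 1 by rewrite ler_pdivrMr// mul1r ltW.
have := g_cvxP w 0 s; rewrite scaler0 addr0 => /(_ _) h.
have {}h : g (s *: w) <= s * g w + (1 - s) * g 0 by apply: h; rewrite ltW.
have := dP (s *: w); rewrite enormZ ger0_norm ?(ltW s0)// divfK ?gt_eqF// lexx => /(_ isT).
have -> : del^-1 * enorm w = s^-1 by rewrite [RHS]invf_div mulrC.
move=> h'; rewrite -(ler_pM2l s0) mulrBr divff ?gt_eqF//; nra.
Qed.

Let obj v w := g w + (2 * mu)^-1 * enorm (w - v) ^+ 2.

Let c := (2 * mu)^-1.
Let c_gt0 : 0 < c. Proof. by rewrite invr_gt0 mulr_gt0. Qed.

Let obj_lb v : has_lbound (range (obj v)).
Proof.
have [A [B [B0 AB]]] := convex_lsc_lower_bound.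
(* The last term completes the square in [c * r ^+ 2 - B * r]. *)
exists (A - B * enorm v - B ^+ 2 / (4 * c)) => _ [w _ <-].
rewrite /obj -/c; set r := enorm (w - v).
have r0 : 0 <= r by exact: enorm_ge0.
have h1 : enorm w <= enorm v + r by rewrite -[X in enorm X](subrKC v) enormD.
have := AB w; have := ler_wpM2l B0 h1 => h2 h3.
have : 0 <= c * r ^+ 2 - B * r + B ^+ 2 / (4 * c).
  have -> : c * r ^+ 2 - B * r + B ^+ 2 / (4 * c) = c * (r - B / (2 * c)) ^+ 2.
    by field; rewrite gt_eqF.
  by rewrite mulr_ge0 ?sqr_ge0// ltW.
by lra.
Qed.

Let obj_inf v : has_inf (range (obj v)).
Proof. by split; [exists (obj v 0), 0|exact: obj_lb]. Qed.

Let moreau_le v w : moreau mu g v <= obj v w.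
Proof. by apply: ge_inf; [exact: obj_lb|exists w]. Qed.

(* The parallelogram identity makes every minimizing sequence of the strongly
   convex objective Cauchy. *)
Let obj_mid v x y :
  c / 4 * dot (x - y) (x - y) <= (obj v x + obj v y) / 2 - moreau mu g v.
Proof.
have half : 0 <= (2^-1 : R) <= 1 by lra.
have := g_cvxP x y 2^-1 half.
set m := _ *: x + _ *: y => h1.
have h2 := moreau_le v m; rewrite /obj -!dot_enorm -/c in h2 *.
have -> : x - y = (x - v) - (y - v) by rewrite opprB addrA subrK.
have mE : m - v = 2^-1 *: ((x - v) + (y - v)).
  rewrite /m (_ : 1 - 2^-1 = 2^-1); last by field.
  rewrite scalerDr !scalerBr addrACA -opprD -scalerDl.
  by rewrite (_ : 2^-1 + 2^-1 = 1) ?scale1r//; field.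
rewrite mE in h2; move: (x - v) (y - v) h2 {mE} => X Y h2.
rewrite dotZl dotZr dotDl !dotDr (dotC Y X) in h2.
rewrite dotBl !dotBr (dotC Y X).
have -> : g x + c * dot X X + (g y + c * dot Y Y) = g x + g y + c * (dot X X + dot Y Y) by ring.
lra.
Qed.

Lemma prox_exists v : exists p, forall w, obj v p <= obj v w.
Proof.
have r01 : 0 <= (2^-1 : R) < 1 by lra.
(* The squared gap makes distances, which are controlled by its square root, decay like
   [2^-1 ^+ k]. *)
have /choice[u uP] (k : nat) : exists w, obj v w < moreau mu g v + (2^-1 ^+ k) ^+ 2.
  have e0 : 0 < (2^-1 ^+ k : R) ^+ 2 by rewrite !exprn_gt0// invr_gt0.
  by have [_ [w _ <-] ?] := inf_adherent e0 (obj_inf v); exists w.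
have cauchy k i : `|u k.+1 i 0 - u k i 0| <= Num.sqrt (4 / c) * 2^-1 ^+ k.
  have c4 : 0 <= 4 / c by rewrite divr_ge0// ltW.
  rewrite -(@ler_pXn2r _ 2)// ?nnegrE ?mulr_ge0 ?sqrtr_ge0 ?exprn_ge0//.
  rewrite real_normK ?num_real// exprMn sqr_sqrtr//.
  have := coord_sqr_le_dot (u k.+1 - u k) i; rewrite !mxE => /le_trans; apply.
  have := obj_mid v (u k.+1) (u k); have := uP k; have := uP k.+1.
  rewrite (exprS _ k) exprMn; set q := (2^-1 ^+ k) ^+ 2.
  have q0 : 0 <= q by exact: sqr_ge0.
  move=> h1 h2 h3; rewrite mulrAC ler_pdivlMr//; nra.
have [p pP] := geometric_cvg_vec _ _ _ r01 cauchy.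
exists p => w; apply: le_trans (moreau_le v w).
have geo0 (C : R) : C * 2^-1 ^+ k @[k --> \oo] --> (0 : R).
  rewrite -(mulr0 C); apply: cvgM; first exact: cvg_cst.
  by apply: cvg_expr; rewrite ger0_norm; lra.
have cu : u k @[k --> \oo] --> p.
  apply/cvg_coordP => i; apply/cvgrPdist_lt => e e0.
  have /cvgrPdist_lt/(_ _ e0) := geo0 (Num.sqrt (4 / c) / (1 - 2^-1)).
  apply: filterS => k; rewrite sub0r normrN => /(le_lt_trans (ler_norm _)).
  exact: le_lt_trans.
rewrite leNgt; apply/negP => gap.
(* One third each for semicontinuity of [g], continuity of the quadratic term, and the optimality
   gap of [u k]. *)
pose e := (obj v p - moreau mu g v) / 3.
have e0 : 0 < e by rewrite divr_gt0// subr_gt0.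
have [del del0 dP] := g_lscP p e e0.
have /cvg_enormP/(_ _ del0) near1 := cu.
have cd : c * enorm (u k - v) ^+ 2 @[k --> \oo] --> c * enorm (p - v) ^+ 2.
  have ce : enorm (u k - v) @[k --> \oo] --> enorm (p - v).
    apply: (@continuous_cvg _ _ _ \oo _ (fun k => u k - v) (@enorm R d)).
      exact: enorm_continuous.
    by apply: cvgB => //; exact: cvg_cst.
  by apply: cvgM; [exact: cvg_cst|exact: cvgM].
have /cvgrPdist_lt/(_ _ e0) near2 := cd.
have /cvgrPdist_lt/(_ _ e0) near3 := geo0 1.
have [k [k1 k2 k3]] : exists k, [/\ enorm (u k - p) < del,
    `|c * enorm (p - v) ^+ 2 - c * enorm (u k - v) ^+ 2| < e &
    `|0 - 1 * 2^-1 ^+ k| < e].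
  near \oo => k; exists k; split; near: k => //.
have := uP k; have := dP (u k) k1.
move: k2; rewrite ltr_norml => /andP[_ k2].
have t0 : 0 <= (2^-1 ^+ k : R) by rewrite exprn_ge0.
have t1 : (2^-1 ^+ k : R) <= 1 by apply: exprn_ile1; lra.
move: k3; rewrite mul1r sub0r normrN ger0_norm// => k3.
have t2 : (2^-1 ^+ k : R) ^+ 2 <= 2^-1 ^+ k by rewrite expr2 ler_piMr.
have e3 : obj v p = moreau mu g v + 3 * e by rewrite /e mulrC divfK// subrKC.
move: e3; rewrite /obj -/c => e3 h1 h2; lra.
Unshelve. all: by end_near. Qed.

(** With [q v = (v - prox v) / mu], the point [v - mu *: q v] is [prox v]. Minimality along the
    segment from [prox v] to [w], for vanishing step, says that [q v] is a subgradient of [g] at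
    [prox v]. *)
Lemma moreau_gradient_exists : exists q : 'cV[R]_d -> 'cV[R]_d,
  (forall v w, g (v - mu *: q v) + dot (q v) (w - (v - mu *: q v)) <= g w) /\
  (forall v, moreau mu g v = g (v - mu *: q v) + mu / 2 * dot (q v) (q v)).
Proof.
have /choice[prox proxP] := prox_exists.
pose q v := mu^-1 *: (v - prox v).
have proxE v : v - mu *: q v = prox v.
  by rewrite /q scalerA divff ?gt_eqF// scale1r subKr.
have E v : dot (v - prox v) (v - prox v) = mu ^+ 2 * dot (q v) (q v).
  rewrite /q dotZl dotZr; field; exact: lt0r_neq0.
exists q; split=> [v w|v]; rewrite proxE.
  set p := prox v.
  rewrite -subr_ge0; apply: (@ge0_right_limit _ _ (c * dot (w - p) (w - p))) => t /andP[t0 t1].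
  have t01 : 0 <= t <= 1 by rewrite ltW.
  have h1 := g_cvxP w p t t01.
  have := proxP v (t *: w + (1 - t) *: p); rewrite /obj -/p -!dot_enorm -/c => h2.
  have mE : t *: w + (1 - t) *: p - v = (p - v) + t *: (w - p).
    by apply/matrixP => i j; rewrite !mxE; ring.
  rewrite mE dot_sqrD in h2.
  have -> : dot (q v) (w - p) = - (2 * c) * dot (p - v) (w - p).
    rewrite /q dotZl -/p -(opprB p v) dotNl /c; field; exact: lt0r_neq0.
  rewrite -(pmulr_rge0 _ t0).
  by lra.
have -> : moreau mu g v = obj v (prox v).
  apply/eqP; rewrite eq_le moreau_le/=; apply: lb_le_inf.
    by exists (obj v 0), 0.
  by move=> _ [w _ <-]; exact: proxP.
rewrite /obj -dot_enorm -(opprB v) dotNl dotNr opprK E; congr (_ + _).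
by field; exact: lt0r_neq0.
Qed.

(** The subgradient inequality between two proximal points yields a lower bound for the envelope
    with surplus [mu / 2 * |q v' - q v|^2]. Added to its mirror image it gives cocoercivity; read
    from [v + h] to [v], its surplus absorbs the Young term and gives the upper bound. *)
Lemma moreau_gradient : exists q : 'cV[R]_d -> 'cV[R]_d, [/\
  forall v1 v2, mu * dot (q v1 - q v2) (q v1 - q v2) <= dot (q v1 - q v2) (v1 - v2),
  forall v h, moreau mu g v + dot (q v) h <= moreau mu g (v + h) &
  forall v h, moreau mu g (v + h) <= moreau mu g v + dot (q v) h + c * dot h h].
Proof.
have [q [q1 q2]] := moreau_gradient_exists.
have lower v v' : moreau mu g v + dot (q v) (v' - v) +
    mu / 2 * dot (q v' - q v) (q v' - q v) <= moreau mu g v'.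
  rewrite !q2; have := q1 v (v' - mu *: q v').
  set p := v - mu *: q v; set p' := v' - mu *: q v' => h.
  have -> : v' - v = p' - p + mu *: (q v' - q v).
    by apply/matrixP => i j; rewrite !mxE; ring.
  move: (p' - p) h => e h.
  rewrite (dotDr (q v) e) dotZr (dotBr (q v)) dotBl !dotBr (dotC (q v') (q v)); lra.
exists q; split=> [v1 v2|v h|v h].
- have h1 := lower v1 v2; have h2 := lower v2 v1.
  rewrite -(opprB (q v1)) dotNl dotNr opprK in h1.
  have e1 : dot (q v1) (v2 - v1) = - dot (q v1) (v1 - v2) by rewrite -dotNr opprB.
  by rewrite e1 in h1; rewrite [leRHS]dotBl; lra.
- have := lower v (v + h); rewrite (addrAC v) subrr add0r.
  by have := dot_ge0 (q (v + h) - q v); have := mu_gt0; nra.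
have := lower (v + h) v; rewrite opprD addrA subrr add0r dotNr => h1.
have := dot_young mu (q (v + h) - q v) h mu_gt0.
rewrite -(opprB (q (v + h))) dotNl dotNr opprK in h1.
rewrite [in X in X -> _]dotBl (_ : c = mu^-1 / 2); last by rewrite /c; field; exact: lt0r_neq0.
lra.
Qed.

End Prox.

(** * First-order bound for strongly convex functions *)

Section Smooth.
Context {R : realType} {n : nat} (f : 'cV[R]_n -> R).

Lemma dot_grad (x h : 'cV[R]_n) : differentiable f x -> 'D_h f x = dot (grad f x) h.
Proof.
move=> df; rewrite deriveE//.
have hE : h = \sum_(i < n) h i 0 *: (delta_mx i 0 : 'cV[R]_n).
  apply/matrixP => i j; rewrite (ord1 j) summxE (bigD1 i)//= !mxE !eqxx mulr1.
  rewrite big1 ?addr0// => k ki; rewrite !mxE eq_sym (negbTE ki) mulr0//.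
rewrite {1}hE linear_sum; apply: eq_bigr => i _.
by rewrite linearZ mxE deriveE// mulrC.
Qed.

(** Convexity of [f - m / 2 * |.|^2] on the segment bounds the difference quotient at [t] by
    [f (x + h) - f x - m / 2 * |h|^2] up to an error linear in [t]. *)
Lemma strongly_convex_gradient (m : R) :
  convex_function setT (fun x => f x - m / 2 * enorm x ^+ 2) ->
  (forall x, differentiable f x) ->
  forall x h, f x + dot (grad f x) h + m / 2 * dot h h <= f (x + h).
Proof.
move=> fc df x h; rewrite -dot_grad//.
have D : derivable f x h by exact: diff_derivable.
suff : forall e, 0 < e -> 'D_h f x <= f (x + h) - f x - m / 2 * dot h h + e.
  by move=> /ler_addgt0Pr; lra.
move=> e e0.
have /cvgrPdist_le/(_ (e / 2)) : t^-1 *: (f (t *: h + x) - f x) @[t --> 0^'] --> 'D_h f x.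
  exact: D.
rewrite divr_gt0// => /(_ isT) near1.
pose B := `|m / 2 * dot h h| + 1; have B0 : 0 < B by rewrite ltr_wpDl.
have [r r0 rP] : exists2 r : R, 0 < r & forall t : R, 0 < t < r ->
    `|'D_h f x - t^-1 *: (f (t *: h + x) - f x)| <= e / 2.
  have /nbhs_ballP[r r0 rP] := near1.
  exists r => // t /andP[t0 tr]; apply: rP; last by rewrite gt_eqF.
  by rewrite /ball/= sub0r normrN gtr0_norm.
(* Small enough to approximate the derivative, to stay on the segment, and to make the error linear
   in [t] at most [e / 2]. *)
pose t := Num.min (r / 2) (Num.min 1 (e / 2 / B)).
have t0 : 0 < t by rewrite !lt_min ltr01 !divr_gt0.
have t1 : t <= 1 by rewrite !ge_min lexx orbT.
have tr : t < r.
  apply: (@le_lt_trans _ _ (r / 2)); first by rewrite ge_min lexx.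
  by rewrite ltr_pdivrMr// ltr_pMr// ltr1n.
have tB : t * B <= e / 2 by rewrite -ler_pdivlMr// !ge_min lexx !orbT.
have := rP t; rewrite t0 tr => /(_ isT).
set Q := t^-1 *: _; rewrite ler_norml => /andP[_ h1].
have t01 : 0 <= t <= 1 by rewrite ltW.
have := convex_functionP _ fc (x + h) x t t01.
have -> : t *: (x + h) + (1 - t) *: x = x + t *: h.
  by apply/matrixP => i j; rewrite !mxE; ring.
rewrite -!dot_enorm dot_sqrD -[x + h](_ : x + 1 *: h = _); last by rewrite scale1r.
rewrite dot_sqrD scale1r => h2.
have h3 : f (x + t *: h) - f x <= t * (f (x + h) - f x - m / 2 * dot h h + t * (m / 2 * dot h h)).
  lra.
have h4 : Q <= f (x + h) - f x - m / 2 * dot h h + t * (m / 2 * dot h h).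
  by rewrite /Q /GRing.scale/= (addrC _ x) ler_pdivrMl.
have h5 : t * (m / 2 * dot h h) <= t * B.
  rewrite ler_pM2l//; apply: (le_trans (ler_norm _)); rewrite /B lerDl//.
lra.
Qed.

End Smooth.

(** * The primal-dual field of the proximal augmented Lagrangian *)

(** The transpose of a right inverse of [T] recovers [y] from [T^T *m y]; its boundedness is the
    claim. *)
Lemma row_free_trmx_lower_bound {R : realType} {d n : nat} (T : 'M[R]_(d, n)) :
  row_free T -> exists2 k : R, 0 < k &
    forall y : 'cV[R]_d, k * dot y y <= dot (T^T *m y) (T^T *m y).
Proof.
move=> Tfree; have [b b0 bP] := mulmx_bounded (pinvmx T)^T.
exists b^-1 => [|y]; first by rewrite invr_gt0.
have := bP (T^T *m y).
by rewrite mulmxA -trmx_mul mulmxVp// trmx1 mul1mx ler_pdivrMl.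
Qed.

Section PrimalDual.
Context {R : realType} {n d : nat} (f : 'cV[R]_n -> R) (g : 'cV[R]_d -> R).
Context (T : 'M[R]_(d, n)) (mu m C : R) (q : 'cV[R]_d -> 'cV[R]_d).
Hypotheses (mu_gt0 : 0 < mu) (m_gt0 : 0 < m) (T_free : row_free T).
Hypothesis f_lower : forall x h,
  f x + dot (grad f x) h + m / 2 * dot h h <= f (x + h).
Hypothesis f_lip : forall x y, enorm (grad f x - grad f y) <= C * enorm (x - y).
Hypothesis q_coco : forall v1 v2,
  mu * dot (q v1 - q v2) (q v1 - q v2) <= dot (q v1 - q v2) (v1 - v2).
Hypothesis q_lower : forall v h,
  moreau mu g v + dot (q v) h <= moreau mu g (v + h).
Hypothesis q_upper : forall v h,
  moreau mu g (v + h) <= moreau mu g v + dot (q v) h + (2 * mu)^-1 * dot h h.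

Let L := prox_aug_lagrangian f g T mu.
Let F := primal_dual_field L.
Let v (x : 'cV[R]_n) (y : 'cV[R]_d) := T *m x + mu *: y.

Let f_lip_norm x y : enorm (grad f x - grad f y) <= `|C| * enorm (x - y).
Proof. by apply: (le_trans (f_lip x y)); rewrite ler_wpM2r ?enorm_ge0// ler_norm. Qed.

Let f_lip2 x y : dot (grad f x - grad f y) (grad f x - grad f y) <=
  C ^+ 2 * dot (x - y) (x - y).
Proof.
rewrite !dot_enorm -(real_normK (num_real C)) -exprMn ler_pXn2r//.
  by rewrite nnegrE enorm_ge0.
by rewrite nnegrE mulr_ge0// enorm_ge0.
Qed.

(** A descent inequality without integration: the lower bound is taken at [x + h] in direction
    [- h], and replacing [grad f (x + h)] by [grad f x] costs the Lipschitz constant. *)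
Let f_upper x h : f (x + h) <= f x + dot (grad f x) h + `|C| * dot h h.
Proof.
have := f_lower (x + h) (- h); rewrite addrK dotNl !dotNr opprK => h1.
have h2 : dot (grad f (x + h) - grad f x) h <= `|C| * dot h h.
  apply: (le_trans (ler_norm _)); apply: (le_trans (dot_le_enorm _ _)).
  rewrite dot_enorm expr2 mulrA ler_wpM2r ?enorm_ge0//.
  by have := f_lip_norm (x + h) x; rewrite (addrAC x) subrr add0r.
rewrite dotBl in h2.
have h3 : 0 <= m / 2 * dot h h by rewrite mulr_ge0 ?dot_ge0// divr_ge0// ltW.
by lra.
Qed.

Let f_mono x y : m * dot (x - y) (x - y) <= dot (grad f x - grad f y) (x - y).
Proof.
have h1 := f_lower x (y - x); have h2 := f_lower y (x - y).
rewrite subrKC in h1; rewrite subrKC in h2.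
rewrite -(opprB x y) !dotNl !dotNr opprK in h1.
by rewrite dotBl; lra.
Qed.

Lemma lagrangian_expansion_x x y :
  quadratic_expansion (fun x => L x y) x (grad f x + T^T *m q (v x y)).
Proof.
have [b b0 bP] := mulmx_bounded T.
have c0 : 0 < (2 * mu)^-1 by rewrite invr_gt0 mulr_gt0.
exists (`|C| + (2 * mu)^-1 * b) => h; rewrite /L /prox_aug_lagrangian -/(v x y).
have -> : T *m (x + h) + mu *: y = v x y + T *m h by rewrite mulmxDr addrAC.
rewrite dotDl dotC (dotC (T^T *m _)) -dot_adj (dotC h) (dotC (T *m h)).
have h1 := f_lower x h; have h2 := f_upper x h.
have h3 := q_lower (v x y) (T *m h); have h4 := q_upper (v x y) (T *m h).
have h5 := ler_wpM2l (ltW c0) (bP h).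
have h6 : 0 <= m / 2 * dot h h by rewrite mulr_ge0 ?dot_ge0// divr_ge0// ltW.
have h7 : 0 <= `|C| * dot h h by rewrite mulr_ge0 ?dot_ge0.
have h8 : 0 <= (2 * mu)^-1 * (b * dot h h).
  by apply: mulr_ge0; [exact: ltW|rewrite mulr_ge0 ?dot_ge0// ltW].
rewrite ler_norml (mulrDl `|C|) -(mulrA _ b); move: h1 h2 h3 h4 h5 h6 h7 h8.
move: (f (x + h)) (f x) (dot (grad f x) h) (moreau mu g (v x y + T *m h))
  (moreau mu g (v x y)) (dot (q (v x y)) (T *m h)) (_ * dot (T *m h) (T *m h))
  (`|C| * dot h h) (_ * (b * dot h h)) (m / 2 * dot h h) (mu / 2 * enorm y ^+ 2).
by move=> *; lra.
Qed.

Lemma lagrangian_expansion_y x y :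
  quadratic_expansion (fun y => L x y) y (mu *: (q (v x y) - y)).
Proof.
exists (mu / 2 + mu / 2) => h; rewrite /L /prox_aug_lagrangian -/(v x y) -!dot_enorm.
have -> : T *m x + mu *: (y + h) = v x y + mu *: h by rewrite scalerDr addrA.
have h3 := q_lower (v x y) (mu *: h); have h4 := q_upper (v x y) (mu *: h).
rewrite !dotZr !dotZl in h3 h4.
have e1 : (2 * mu)^-1 * (mu * (mu * dot h h)) = mu / 2 * dot h h.
  by field; exact: lt0r_neq0.
rewrite e1 in h4.
have -> : dot (y + h) (y + h) = dot y y + 2 * dot y h + dot h h.
  by rewrite -{1 2}(scale1r h) dot_sqrD mulr1 expr1n mul1r.
rewrite dotZl dotBl.
have h6 : 0 <= mu / 2 * dot h h by rewrite mulr_ge0 ?dot_ge0// divr_ge0// ltW.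
rewrite ler_norml mulrDl; move: h3 h4 h6; rewrite !mulrBr !mulrDr.
move: (mu) (moreau mu g (v x y + mu *: h)) (moreau mu g (v x y)) (mu / 2 * dot h h)
  (mu * dot (q (v x y)) h) (dot y h) (dot y y) (f x).
by move=> *; lra.
Qed.

Lemma primal_dual_fieldE x y : F (col_mx x y) =
  col_mx (- (grad f x + T^T *m q (v x y))) (mu *: (q (v x y) - y)).
Proof.
rewrite /F /primal_dual_field col_mxKu col_mxKd.
rewrite (quadratic_expansion_grad _ _ _ (lagrangian_expansion_x x y)).
by rewrite (quadratic_expansion_grad _ _ _ (lagrangian_expansion_y x y)).
Qed.

(** At a zero, [q = ys]. In [y], the envelope's upper bound for the increment [mu *: h] gains at
    most [mu / 2 * |h|^2] beyond its linear part, exactly what [- mu / 2 * |y|^2] takes away. In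
    [x], the two lower bounds add up with zero slope. *)
Lemma primal_dual_zero_saddle z : F z = 0 -> is_saddle_point L z.
Proof.
rewrite -[z]vsubmxK; set xs := usubmx z; set ys := dsubmx z.
rewrite primal_dual_fieldE => /eqP; rewrite col_mx_eq0 oppr_eq0 => /andP[/eqP Fx /eqP Fy].
move: Fy => /eqP; rewrite scaler_eq0 gt_eqF//= subr_eq0 => /eqP qy.
move=> x y; rewrite col_mxKu col_mxKd; apply/andP; split.
  have -> : y = ys + (y - ys) by rewrite subrKC.
  move: (y - ys) => h; rewrite /L /prox_aug_lagrangian -/(v xs ys) -!dot_enorm.
  have -> : T *m xs + mu *: (ys + h) = v xs ys + mu *: h by rewrite scalerDr addrA.
  have := q_upper (v xs ys) (mu *: h); rewrite qy !dotZr !dotZl.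
  have -> : (2 * mu)^-1 * (mu * (mu * dot h h)) = mu / 2 * dot h h.
    by field; exact: lt0r_neq0.
  have -> : dot (ys + h) (ys + h) = dot ys ys + 2 * dot ys h + dot h h.
    by rewrite -{1 2}(scale1r h) dot_sqrD mulr1 expr1n mul1r.
  move: (mu) (moreau mu g (v xs ys + mu *: h)) (moreau mu g (v xs ys)) (f xs)
    (dot ys ys) (dot ys h) (dot h h).
  by move=> *; lra.
have -> : x = xs + (x - xs) by rewrite subrKC.
move: (x - xs) => h; rewrite /L /prox_aug_lagrangian -/(v xs ys).
have -> : T *m (xs + h) + mu *: ys = v xs ys + T *m h by rewrite mulmxDr addrAC.
have h1 := f_lower xs h; have h3 := q_lower (v xs ys) (T *m h).
have : dot (grad f xs + T^T *m q (v xs ys)) h = 0 by rewrite Fx dot0l.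
rewrite dotDl (dotC (T^T *m _)) -dot_adj (dotC (T *m h)) => h4.
have h6 : 0 <= m / 2 * dot h h by rewrite mulr_ge0 ?dot_ge0// divr_ge0// ltW.
move: h1 h3 h4 h6; move: (moreau mu g (v xs ys + T *m h)) (moreau mu g (v xs ys))
  (f xs) (f (xs + h)) (dot (grad f xs) h) (m / 2 * dot h h) (mu / 2 * enorm ys ^+ 2).
by move=> *; lra.
Qed.

Lemma saddle_primal_dual_zero z : is_saddle_point L z -> F z = 0.
Proof.
rewrite -[z]vsubmxK; set xs := usubmx z; set ys := dsubmx z => saddle.
rewrite primal_dual_fieldE.
have hx y : L xs ys <= L y ys.
  by have := saddle y ys; rewrite col_mxKu col_mxKd => /andP[].
have hy y : - L xs ys <= - L xs y.
  by have := saddle xs y; rewrite col_mxKu col_mxKd lerN2 => /andP[].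
rewrite (quadratic_expansion_min _ _ _ (lagrangian_expansion_x xs ys))//.
have := quadratic_expansion_min _ _ _ (quadratic_expansionN _ _ _ (lagrangian_expansion_y xs ys)).
by move=> /(_ hy)/eqP; rewrite oppr_eq0 => /eqP ->; rewrite oppr0 col_mx0.
Qed.

Lemma primal_dual_field_lipschitz : exists2 K : R, 0 < K &
  forall z1 z2, enorm (F z1 - F z2) <= K * enorm (z1 - z2).
Proof.
have [t t0 tP] := mulmx_bounded T; have [t' t'0 t'P] := mulmx_bounded T^T.
have sq2 k (u w : 'cV[R]_k) : dot (u + w) (u + w) <= 2 * dot u u + 2 * dot w w.
  have := dot_ge0 (u - w); rewrite dotBl !dotBr dotDl !dotDr (dotC w u); lra.
(* [Q] bounds the squared increment of [q], which is [1 / mu]-Lipschitz by cocoercivity, in terms of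
   those of [x] and [y]. *)
pose Q := (2 * t + 2 * mu ^+ 2) / mu ^+ 2.
have mu2 : 0 < mu ^+ 2 by rewrite exprn_gt0.
have Q0 : 0 < Q by rewrite divr_gt0// addr_gt0// mulr_gt0.
pose K2 := 2 * C ^+ 2 + (2 * t' + 2 * mu ^+ 2) * Q + 2 * mu ^+ 2.
have K20 : 0 < K2.
  apply: ltr_wpDl; last by rewrite mulr_gt0.
  apply: addr_ge0; first by rewrite mulr_ge0 ?sqr_ge0.
  by rewrite mulr_ge0 ?(ltW Q0)// addr_ge0// mulr_ge0// ltW.
exists (Num.sqrt K2); first by rewrite sqrtr_gt0.
move=> z1 z2; rewrite -(@ler_pXn2r _ 2)// ?nnegrE ?enorm_ge0//; last first.
  by rewrite mulr_ge0 ?enorm_ge0// sqrtr_ge0.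
rewrite [leRHS]exprMn (sqr_sqrtr (ltW K20)) -!dot_enorm.
rewrite -[z1]vsubmxK -[z2]vsubmxK.
move: (usubmx z1) (dsubmx z1) (usubmx z2) (dsubmx z2) => x1 y1 x2 y2.
rewrite !primal_dual_fieldE !opp_col_mx !add_col_mx !dot_col_mx.
set v1 := v x1 y1; set v2 := v x2 y2.
have -> : - (grad f x1 + T^T *m q v1) - - (grad f x2 + T^T *m q v2) =
    - ((grad f x1 - grad f x2) + T^T *m (q v1 - q v2)).
  by rewrite mulmxBr opprK !opprD !opprK addrACA.
rewrite dotNl dotNr opprK -scalerBr dotZl dotZr.
have -> : q v1 - y1 - (q v2 - y2) = (q v1 - q v2) + - (y1 - y2).
  by apply/matrixP => i j; rewrite !mxE; ring.
have vE : v1 - v2 = T *m (x1 - x2) + mu *: (y1 - y2).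
  by rewrite /v1 /v2 /v mulmxBr scalerBr opprD addrACA.
have h0 := q_coco v1 v2; rewrite vE in h0.
move: (q v1 - q v2) h0 => r h0.
have ha := f_lip2 x1 x2.
move: (grad f x1 - grad f x2) ha => a ha.
move: (x1 - x2) (y1 - y2) h0 ha {vE} => x y h0 ha.
have s1 := sq2 _ a (T^T *m r); have s2 := sq2 _ r (- y); rewrite dotNl dotNr opprK in s2.
have s3 := sq2 _ (T *m x) (mu *: y); rewrite !dotZr !dotZl in s3.
have s4 := t'P r; have s5 := tP x.
have hr : mu ^+ 2 * dot r r <= dot (T *m x + mu *: y) (T *m x + mu *: y).
  have := dot_young mu r (T *m x + mu *: y) mu_gt0 => h.
  have h' : mu * dot r r <= mu^-1 * dot (T *m x + mu *: y) (T *m x + mu *: y) by lra.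
  have := ler_wpM2l (ltW mu_gt0) h'; rewrite (mulrA mu mu^-1) divff ?gt_eqF// mul1r.
  by rewrite mulrA -expr2.
have X0 := dot_ge0 x; have Y0 := dot_ge0 y; have R0 := dot_ge0 r.
have hr2 : dot r r <= Q * (dot x x + dot y y).
  rewrite /Q mulrAC ler_pdivlMr// mulrC; apply: (le_trans hr); apply: (le_trans s3).
  have := mulr_ge0 (ltW t0) Y0; have := mulr_ge0 (ltW mu2) X0; lra.
have b1 := ler_wpM2l (ltW mu2) s2.
have b2 : (2 * t' + 2 * mu ^+ 2) * dot r r <= (2 * t' + 2 * mu ^+ 2) * (Q * (dot x x + dot y y)).
  by rewrite ler_wpM2l// addr_ge0// mulr_ge0// ltW.
have b3 : 0 <= C ^+ 2 * dot y y by rewrite mulr_ge0 ?sqr_ge0.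
have b4 : 0 <= mu ^+ 2 * dot x x by exact: mulr_ge0 (ltW mu2) X0.
rewrite mulrA -expr2 /K2; move: s1 s4 ha b1 b2 b3 b4.
move: (dot (a + T^T *m r) _) (dot (T^T *m r) _) (dot (r - y) _) (dot a a)
  (dot r r) (dot x x) (dot y y) (mu ^+ 2) (C ^+ 2) (Q).
by move=> *; lra.
Qed.

(* Without the cross term [e], the quadratic form only controls [x] and
   [q - y]; the flow of [x] is driven by [- T^T q], which is close to
   [- T^T y], so a small multiple of [<T x, y>] recovers [y]. *)
Let P (e : R) : 'M[R]_(n + d) := block_mx 1%:M (e *: T^T) (e *: T) 1%:M.

Lemma primal_dual_field_monotone : exists e c, [/\ 0 < c, (P e)^T = P e,
  forall u : 'cV[R]_(n + d), 1 / 2 * dot u u <= dot u (P e *m u),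
  forall u : 'cV[R]_(n + d), dot u (P e *m u) <= 3 / 2 * dot u u &
  forall z1 z2, dot (z1 - z2) (P e *m (F z1 - F z2)) <= - c * dot (z1 - z2) (z1 - z2)].
Proof.
have [t t0 tP] := mulmx_bounded T; have [t' t'0 t'P] := mulmx_bounded T^T.
have [k k0 kP] := row_free_trmx_lower_bound T T_free.
(* What the cross term costs, per unit of [e], on the squared increments of [x] and of [q - y]. *)
pose c1 := mu / 2 * t + C ^+ 2; pose c2 := mu / 2 + t'.
have c10 : 0 < c1 by rewrite ltr_wpDr ?sqr_ge0// mulr_gt0// divr_gt0.
have c20 : 0 < c2 by rewrite addr_gt0// divr_gt0.
(* The first two entries let the cross term spend at most half of the decay of [x] and all of that
   of [q - y]; the third keeps the form between [1 / 2] and [3 / 2] of the Euclidean one. *)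
pose e := Num.min (m / (2 * c1)) (Num.min (mu / c2) (1 / (2 * (t + 1)))).
have t10 : 0 < t + 1 by rewrite addr_gt0.
have e0 : 0 < e by rewrite !lt_min !divr_gt0 ?mulr_gt0.
have e1 : e * c1 <= m / 2.
  by rewrite -ler_pdivlMr// -mulrA -invfM ge_min lexx.
have e2 : e * c2 <= mu by rewrite -ler_pdivlMr// !ge_min lexx !orbT.
have e3 : e * (t + 1) <= 1 / 2.
  by rewrite -ler_pdivlMr// -mulrA -invfM !ge_min lexx !orbT.
pose c := Num.min (m / 2) (e * k / 2).
have c0 : 0 < c by rewrite lt_min !divr_gt0// mulr_gt0.
have PE (x1 x2 : 'cV[R]_n) (y1 y2 : 'cV[R]_d) : dot (col_mx x1 y1) (P e *m col_mx x2 y2) =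
    dot x1 x2 + dot y1 y2 + e * (dot (T *m x1) y2 + dot (T *m x2) y1).
  rewrite mul_block_col !mul1mx -!scalemxAl dot_col_mx !dotDr !dotZr -dot_adj.
  by rewrite (dotC y1 (T *m x2)); ring.
have cross x y : `|2 * dot (T *m x) y| <= t * dot x x + dot y y.
  have := dot_young 1 (T *m x) y ltr01; have := dot_young' 1 (T *m x) y ltr01.
  by have := tP x; rewrite invr1 !mul1r ler_norml; lra.
have crosse x y : `|e * (2 * dot (T *m x) y)| <= 1 / 2 * (dot x x + dot y y).
  rewrite normrM gtr0_norm//; apply: (le_trans (ler_wpM2l (ltW e0) (cross x y))).
  have := ler_wpM2r (dot_ge0 x) e3; have := ler_wpM2r (dot_ge0 y) e3.
  have := mulr_ge0 (mulr_ge0 (ltW e0) (ltW t0)) (dot_ge0 y).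
  by have := mulr_ge0 (ltW e0) (dot_ge0 x); lra.
exists e, c; split => //.
- by rewrite /P tr_block_mx !trmx1 !linearZ/= trmxK.
- move=> u; rewrite -[u]vsubmxK; move: (usubmx u) (dsubmx u) => x y.
  have := crosse x y; rewrite PE dot_col_mx ler_norml => /andP[? _]; lra.
- move=> u; rewrite -[u]vsubmxK; move: (usubmx u) (dsubmx u) => x y.
  have := crosse x y; rewrite PE dot_col_mx ler_norml => /andP[_ ?]; lra.
move=> z1 z2; rewrite -[z1]vsubmxK -[z2]vsubmxK.
move: (usubmx z1) (dsubmx z1) (usubmx z2) (dsubmx z2) => x1 y1 x2 y2.
rewrite !primal_dual_fieldE !opp_col_mx !add_col_mx PE dot_col_mx.
set v1 := v x1 y1; set v2 := v x2 y2.
have -> : - (grad f x1 + T^T *m q v1) - - (grad f x2 + T^T *m q v2) =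
    - ((grad f x1 - grad f x2) + T^T *m (q v1 - q v2)).
  by rewrite mulmxBr opprK !opprD !opprK addrACA.
rewrite -scalerBr.
have -> : q v1 - y1 - (q v2 - y2) = (q v1 - q v2) - (y1 - y2).
  by apply/matrixP => i j; rewrite !mxE; ring.
have vE : v1 - v2 = T *m (x1 - x2) + mu *: (y1 - y2).
  by rewrite /v1 /v2 /v mulmxBr scalerBr opprD addrACA.
have h0 := q_coco v1 v2; rewrite vE in h0.
move: (q v1 - q v2) h0 => s h0.
have ha := f_lip2 x1 x2; have hm := f_mono x1 x2.
move: (grad f x1 - grad f x2) ha hm => a ha hm.
move: (x1 - x2) (y1 - y2) h0 ha hm {vE} => x y h0 ha hm.
pose r := s - y; have sE : s = r + y by rewrite subrK.
have E1 : dot x (- (a + T^T *m s)) = - dot a x - dot (T *m x) s.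
  by rewrite dotNr dotDr -dot_adj (dotC x a); ring.
have E2 : dot y (mu *: r) = mu * dot y s - mu * dot y y.
  by rewrite dotZr /r dotBr; ring.
have E3 : dot (T *m x) (mu *: r) = mu * dot (T *m x) r by rewrite dotZr.
have E4 : dot (T *m - (a + T^T *m s)) y = - dot (T^T *m y) a
    - dot (T^T *m y) (T^T *m r) - dot (T^T *m y) (T^T *m y).
  rewrite dot_adj dotNl dotDl sE mulmxDr dotDl (dotC a) (dotC (T^T *m r)); ring.
have rr : dot r r = dot s s - 2 * dot y s + dot y y.
  by rewrite /r dotBl !dotBr (dotC s y); ring.
have hs : mu * dot s s <= dot (T *m x) s + mu * dot y s.
  by move: h0; rewrite dotDr dotZr (dotC s (T *m x)) (dotC s y).
rewrite -/r {}E1 {}E2 {}E3 {}E4 {h0 sE}.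
have half0 : 0 < (2^-1 : R) by rewrite invr_gt0.
have b1 := dot_young 1 (T *m x) r ltr01; rewrite invr1 !mul1r in b1.
have b2 := dot_young' 2^-1 (T^T *m y) a half0; rewrite invrK in b2.
have b3 := dot_young' 2^-1 (T^T *m y) (T^T *m r) half0; rewrite invrK in b3.
have tx := tP x; have tr := t'P r; have ky := kP y.
have X0 := dot_ge0 x; have Y0 := dot_ge0 y; have R0 := dot_ge0 r.
move: (dot (T *m x) s) (dot (T *m x) r) (dot (T *m x) (T *m x)) (dot (T^T *m y) a)
  (dot (T^T *m y) (T^T *m r)) (dot (T^T *m y) (T^T *m y))
  (dot (T^T *m r) (T^T *m r)) (dot a a) (dot a x) (dot y s) (dot s s) (dot y y)
  (dot x x) (dot r r) ha hm rr hs b1 b2 b3 tx tr ky X0 Y0 R0.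
move=> txs txr ttx tya tytr Z ttr A ax ys ss Y X RR ha hm rr hs b1 b2 b3 tx tr ky X0 Y0 R0.
(* Two Young inequalities with weight [1 / 2] each consume a quarter of [Z = |T^T y|^2]; the
   remaining half is bounded below through [k]. *)
have W : mu * txr + (- tya - tytr - Z) <= - (2^-1 * (k * Y)) + c1 * X + c2 * RR.
  have w1 := ler_wpM2l (ltW mu_gt0) b1; have w2 := ler_wpM2l (ltW mu_gt0) tx.
  by rewrite /c1 /c2; lra.
have eW := ler_wpM2l (ltW e0) W.
have w3 := ler_wpM2r X0 e1; have w4 := ler_wpM2r R0 e2.
have w5 : c * (X + Y) <= m / 2 * X + e * k / 2 * Y.
  by rewrite mulrDr lerD// ler_wpM2r// ge_min lexx ?orbT.
(* Cocoercivity bounds the terms without [e] by [- m * X - mu * ss + 2 * mu * ys - mu * Y]; this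
   identity recognizes the last three as [- mu * RR]. *)
have w6 : mu * RR = mu * ss - 2 * (mu * ys) + mu * Y by rewrite rr; ring.
move: {W} eW w3 w4 w5 w6 hs hm; clear => *; lra.
Qed.

End PrimalDual.

Theorem corollary1 (R : realType) (n d : nat)
    (f : 'cV[R]_n -> R) (g : 'cV[R]_d -> R) (T : 'M[R]_(d, n))
    (f_sc : strongly_convex f) (f_lip : lipschitz_gradient f)
    (g_lsc : lower_semicontinuous (fun w => (g w)%:E))
    (g_cvx : convex_function setT g)
    (T_full : row_free T)
    (mu eta1 eta2 lambda1 lambda2 : R)
    (mu_gt0 : 0 < mu) (eta1_gt0 : 0 < eta1) (eta2_gt0 : 0 < eta2)
    (lambda1_01 : 0 < lambda1 < 1) (lambda2_gt0 : 0 < lambda2) :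
  let L := prox_aug_lagrangian f g T mu in
  let F := primal_dual_field L in
  let sigma := rescaling eta1 eta2 lambda1 lambda2 F in
  exists zs : 'cV[R]_(n + d),
    [/\ is_saddle_point L zs,
        forall z, is_saddle_point L z -> z = zs &
        globally_fixed_time_stable (fun z => sigma z *: F z) zs].
Proof.
move=> L F sigma.
have [m m_gt0 f_cvx] := f_sc; have [f_diff [C f_grad_lip]] := f_lip.
have f_lower := strongly_convex_gradient _ _ f_cvx f_diff.
have [q [q_coco q_lower q_upper]] := moreau_gradient g mu g_lsc g_cvx mu_gt0.
have [K K_gt0 F_lip] := primal_dual_field_lipschitz f g T mu m C q
  mu_gt0 m_gt0 f_lower f_grad_lip q_coco q_lower q_upper.
have [e [c [c_gt0 P_sym P_ge P_le F_mono]]] := primal_dual_field_monotone f g T mu m C q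
  mu_gt0 m_gt0 T_full f_lower f_grad_lip q_coco q_lower q_upper.
have a_gt0 : 0 < 1 / 2 :> R by rewrite divr_gt0.
have b_gt0 : 0 < 3 / 2 :> R by rewrite divr_gt0.
have [zs Fzs] := strongly_monotone_zero F _ K _ _ c K_gt0 a_gt0 b_gt0 c_gt0
  P_sym P_ge P_le F_lip F_mono.
(* Existence and uniqueness of the saddle point are thereby those of the zero of [F]. *)
have saddleE z : is_saddle_point L z <-> F z = 0.
  split.
    exact: (saddle_primal_dual_zero f g T mu m C q).
  exact: (primal_dual_zero_saddle f g T mu m C q).
exists zs; split; first exact/saddleE.
  move=> z /saddleE Fz.
  exact: (strongly_monotone_zero_unique F _ c c_gt0 F_mono).
exact: (strongly_monotone_fixed_time_stable F _ K _ _ c K_gt0 a_gt0 b_gt0 c_gt0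
  P_sym P_ge P_le F_lip F_mono zs Fzs _ _ _ _ eta1_gt0 eta2_gt0 lambda1_01 lambda2_gt0).
Qed.
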